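(* Let $R=\mathbb{Z}[x_1,x_2,\ldots]$ be the ring of polynomials with integer coefficients in countably many commuting variables. Each of the following three rings is isomorphic to $R$: (i) the ring $\tilde\Gamma$ of simple graphs with integer-weighted components, with multiplication induced by the Cartesian product; (ii) the ring $\tilde\Gamma$ with multiplication induced by the strong product; (iii) the subring $\tilde\Gamma_{0,\mathrm{odd}}$ of $\tilde\Gamma_0$ additively generated by the connected nonbipartite graphs (loops allowed), with multiplication induced by the direct product.
   Context: Graphs are finite, undirected, considered up to isomorphism; $\Gamma_0$ denotes all such graphs (loops allowed), $\Gamma$ the simple ones. Cartesian product $G\,\Box\,H$ on $V(G)\times V(H)$: $(u,v)\sim(u',v')$ iff ($u=u'$ and $(v,v')\in E(H)$) or ($(u,u')\in E(G)$ and $v=v'$). Strong product $G\boxtimes H$: distinct $(u,v),(u',v')$ adjacent iff ($u=u'$ or $(u,u')\in E(G)$) and ($v=v'$ or $(v,v')\in E(H)$), and $(u,v)$ has a loop iff $u$ or $v$ has one. Direct product $G\times H$: $(u,v)\sim(u',v')$ iff $(u,u')\in E(G)$ and $(v,v')\in E(H)$. The set $\tilde\Gamma_0$ (resp. $\tilde\Gamma$) of graphs with integer-weighted components consists of formal finite sums $\sum_G a_G G$ with $a_G\in\mathbb{Z}$, $G$ ranging over connected graphs in $\Gamma_0$ (resp. connected simple graphs); it is the free abelian group on these connected graphs, addition being coefficientwise, and a graph with nonnegative weights corresponds to the disjoint union of its components with multiplicities. For a product $\odot$, multiplication is $(\sum a_H H)\odot(\sum b_L L)=\sum_G\big(\sum_{H\odot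 L=G}a_Hb_L\big)G$, i.e. the bilinear extension of $\odot$ on connected graphs. The unit is $K_1$ (one vertex) for Cartesian/strong and $K_1^*$ (one vertex with a loop) for direct. *)

(* Defs.v *)
From HB Require Import structures.
From mathcomp Require Import all_boot all_order all_algebra all_fingroup.
From mathcomp Require Import finmap.
From mathcomp Require Import monalg.

Set Implicit Arguments.
Unset Strict Implicit.
Unset Printing Implicit Defensive.

Import GRing.Theory.
Local Open Scope ring_scope.

(* The target ring R = Z[x_0, x_1, x_2, ...]: the monoid algebra over  *)
(* int of the free commutative monoid on countably many variables      *)
(* (indexed by nat).  This is a comRingType.                           *)
Definition Zpoly_inf := {malg int[{cmonom nat}]}.

Definition graph := {n : nat & {ffun 'I_n * 'I_n -> bool}}.

Definition V (G : graph) := 'I_(tag G).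
Definition adj (G : graph) (u v : V G) : bool := tagged G (u, v).

Definition undirected (G : graph) : bool :=
  [forall u : V G, forall v : V G, adj u v == adj v u].

Definition simple (G : graph) : bool :=
  undirected G && [forall u : V G, ~~ adj u u].

Definition connected (G : graph) : bool :=
  (0 < tag G)%N && [forall u : V G, forall v : V G, connect (@adj G) u v].

Definition bipartite (G : graph) : bool :=
  [exists c : {ffun V G -> bool},
     forall u : V G, forall v : V G, adj u v ==> (c u != c v)].

Definition mkgraph (T : finType) (r : T -> T -> bool) : graph :=
  Tagged (fun n => {ffun 'I_n * 'I_n -> bool}) 
    [ffun p : 'I_#|T| * 'I_#|T| => r (enum_val p.1) (enum_val p.2)].

(* Graph isomorphism classes: canonical representative = the first
   relation on 'I_n (in enumeration order) isomorphic to G.  Two graphs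
   are isomorphic iff they have the same canonical representative.     *)
Definition canon (G : graph) : graph :=
  match [pick r : {ffun 'I_(tag G) * 'I_(tag G) -> bool} |
          [exists p : {perm 'I_(tag G)},
             forall u : 'I_(tag G), forall v : 'I_(tag G),
               tagged G (u, v) == r (p u, p v)]] with
  | Some r => Tagged (fun n => {ffun 'I_n * 'I_n -> bool}) r
  | None => G
  end.

Definition K1 : graph :=
  Tagged (fun n => {ffun 'I_n * 'I_n -> bool}) [ffun _ : 'I_1 * 'I_1 => false].
Definition K1loop : graph :=
  Tagged (fun n => {ffun 'I_n * 'I_n -> bool}) [ffun _ : 'I_1 * 'I_1 => true].

Definition cartesian (G H : graph) : graph :=
  @mkgraph (V G * V H)%type (fun p q =>
    ((p.1 == q.1) && adj p.2 q.2) || (adj p.1 q.1 && (p.2 == q.2))).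

Definition strong (G H : graph) : graph :=
  @mkgraph (V G * V H)%type (fun p q =>
    if p == q then adj p.1 p.1 || adj p.2 p.2
    else ((p.1 == q.1) || adj p.1 q.1) && ((p.2 == q.2) || adj p.2 q.2)).

Definition direct (G H : graph) : graph :=
  @mkgraph (V G * V H)%type (fun p q => adj p.1 q.1 && adj p.2 q.2).

Definition wgraph := {malg int[graph]}.

Definition wmul (op : graph -> graph -> graph) (x y : wgraph) : wgraph :=
  \sum_(a <- msupp x) \sum_(b <- msupp y)
     << x@_a * y@_b *g canon (op a b) >>.

Definition supported_on (P : graph -> bool) (x : wgraph) : bool :=
  all (fun k => (canon k == k) && P k) (msupp x).

Definition conn_simple (G : graph) : bool := simple G && connected G.
Definition conn_nonbip (G : graph) : bool :=
  undirected G && connected G && ~~ bipartite G.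

Definition ring_iso_to_Zpoly (P : graph -> bool)
    (mul : wgraph -> wgraph -> wgraph) (one : wgraph) : Prop :=
  [/\ supported_on P one,
      {in supported_on P &, forall x y, supported_on P (mul x y)} &
      exists f : wgraph -> Zpoly_inf,
        [/\ {in supported_on P &, forall x y, f (x + y) = f x + f y},
            {in supported_on P &, forall x y, f (mul x y) = f x * f y},
            f one = 1,
            {in supported_on P &, injective f} &
            forall r : Zpoly_inf, exists2 x, supported_on P x & f x = r]].

(* Main.v *)
(* In each case the isomorphism classes of the allowed connected graphs form a
   commutative monoid with the refinement property: A B = C D implies A = P Q,
   B = S T, C = P S, D = Q T.  The number of vertices is multiplicative and is 1
   only for the unit, so irreducibles are prime and cancellable and the monoid is
   free; it has members of every order, and those of prime order are irreducible,
   so the rank is countably infinite.  The ring is then the monoid algebra of the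
   free commutative monoid on countably many generators.

   Refinement rests on a multiplicative metric.  Give each pair of vertices a step
   weight in [0, 1] and let s(x, y) be the largest weight of a walk from x to y.
   If the weights of a product are compatible with those of its factors, then
   s = s_A s_B = s_C s_D on A B = C D, and this alone forces the two
   decompositions into coordinates to commute, hence to have a common refinement.
   For the Cartesian product, an edge has weight 1/2.  For the direct product of
   graphs without twins, the weight is |N(x) & N(y)|^2 / (|N(x)| |N(y)|), which is
   positive exactly when x and y have a common neighbour; nonbipartiteness makes
   that relation connected.  Twins are put back by refining the sizes
   of the twin classes with gcds.  The strong product is the direct product of the
   graphs with all loops added. *)

From mathcomp Require Import all_boot all_order all_algebra all_fingroup.
From mathcomp Require Import finmap monalg.
From mathcomp Require Import boolp classical_sets functions cardinality.
From mathcomp Require Import zify.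
Require Import Defs.

Set Implicit Arguments.
Unset Strict Implicit.
Unset Printing Implicit Defensive.

(** * Free commutative monoids *)

(** Unbounded [sz] keeps [Q] from being finite, and an infinite subset of a countable type is
    equinumerous with [nat]. This indexes the irreducibles by all of [nat]. *)
Lemma infinite_enum (K : countType) (sz : K -> nat) (Q : K -> Prop) :
  (forall n, exists2 x, Q x & n <= sz x) ->
  exists i : nat -> K,
    [/\ injective i, forall n, Q (i n) & forall x, Q x -> exists n, i n = x].
Proof.
move=> Qinf; pose A := [set x | Q x]%classic.
have cA : countable A by exact: countableP.
have iA : infinite_set A.
  move=> fA; have [s Es] := (finite_seqP _).1 fA.
  have [x Qx lex] := Qinf (\max_(y <- s) sz y).+1.
  have xs : x \in s by have := Qx; rewrite -[Q x]/(A x) Es.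
  by have := leq_trans lex (@leq_bigmax_seq _ s xpredT sz x xs isT); rewrite ltnn.
have /card_set_bijP[f [_ finj fsurj]] : (A #= [set: nat])%card.
  exact: eq_card_nat.
have g n : {x | Q x & f x = n}.
  by apply/cid2; have [x Ax fx] := fsurj n I; exists x.
have gK n : f (s2val (g n)) = n by case: (g n).
have gQ n : Q (s2val (g n)) by case: (g n).
exists (fun n => s2val (g n)); split=> //.
- by move=> m n E; rewrite -(gK m) -(gK n) E.
- by move=> x Qx; exists (f x); apply: finj; rewrite ?inE ?gK //; exact: gQ.
Qed.

Section FreeMonoid.
Variables (K : countType) (e : K) (mul : K -> K -> K) (sz : K -> nat).
Hypotheses (mulA : associative mul) (mulC : commutative mul)
  (mul1 : left_id e mul).
Hypotheses (szM : forall x y, sz (mul x y) = sz x * sz y)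
  (sz_gt0 : forall x, 0 < sz x) (sz_eq1 : forall x, sz x = 1 -> x = e)
  (sz_surj : forall n, 0 < n -> exists x, sz x = n).
Hypothesis refine : forall a b c d, mul a b = mul c d ->
  exists p q s t, [/\ a = mul p q, b = mul s t, c = mul p s & d = mul q t].

Let irred x := x <> e /\ forall y z, x = mul y z -> y = e \/ z = e.

Let sz_e : sz e = 1.
Proof.
by have /eqP := szM e e; rewrite mul1 -{1}[sz e]muln1 eqn_pmul2l // => /eqP.
Qed.

Let mul_eqe x y : mul x y = e -> x = e /\ y = e.
Proof.
move=> /(congr1 sz); rewrite szM sz_e => /eqP; rewrite muln_eq1.
by case/andP=> /eqP/sz_eq1 -> /eqP/sz_eq1 ->.
Qed.

Let mul_id x y : mul x y = x -> y = e.
Proof.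
move=> /(congr1 sz)/eqP; rewrite szM -{2}[sz x]muln1 eqn_pmul2l //.
by move=> /eqP/sz_eq1.
Qed.

(** In a refinement of [mul p b = mul p d] the irreducible [p] fills a single cell. If both copies
    of [p] share that cell, then [b] and [d] are both the opposite cell; otherwise [b] and [d] are
    both [mul p t] for the same [t]. *)
Let irred_cancel p b d : irred p -> mul p b = mul p d -> b = d.
Proof.
move=> [_ ip] /refine[u [v [s [t [Ep Eb Ep' Ed]]]]].
case: (ip _ _ Ep) => E; rewrite E in Ep Ep' Eb Ed.
  by rewrite Eb Ed -[s]mul1 -Ep' -[v]mul1 -Ep.
rewrite [mul u e]mulC mul1 in Ep; rewrite -Ep in Ep'.
by rewrite Eb Ed (mul_id (esym Ep')).
Qed.

(** The irreducible [p] equals one of the two cells into which refinement splits it, and that cell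
    is a factor of [c] or of [d]. *)
Let irred_dvd p b c d : irred p -> mul p b = mul c d ->
  (exists x, c = mul p x) \/ (exists x, d = mul p x).
Proof.
move=> [_ ip] /refine[u [v [s [t [Ep Eb Ec Ed]]]]].
case: (ip _ _ Ep) => E; rewrite E in Ep.
  by right; exists t; rewrite Ed Ep mul1.
by left; exists s; rewrite Ec Ep [mul u e]mulC mul1.
Qed.

(** Sizes multiply, so an element of prime size is irreducible, and there are arbitrarily large
    primes. *)
Let irred_inf n : exists2 x, irred x & n <= sz x.
Proof.
have [p np pp] := prime_above n.
have [x szx] := sz_surj (prime_gt0 pp).
exists x; last by rewrite szx ltnW.
split=> [xe|y z Ex]; first by move: pp; rewrite -szx xe sz_e.
have := pp; rewrite -szx Ex szM => /primeP[_ /(_ (sz y))].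
rewrite dvdn_mulr // => /(_ isT)/orP[/eqP/sz_eq1|]; first by left.
rewrite -{1}[sz y]muln1 eqn_pmul2l // => /eqP/esym/sz_eq1; by right.
Qed.

(** Factorisations into irreducibles exist by induction on [sz], and are unique up to order because
    irreducibles are prime and cancel; [psi] records the exponents. *)
Lemma free_comm_monoid : exists psi : K -> {cmonom nat},
  [/\ psi e = mone, forall x y, psi (mul x y) = mmul (psi x) (psi y),
      injective psi & forall m, exists x, psi x = m].
Proof.
have [i [inj_i irr_i surj_i]] := infinite_enum irred_inf.
pose lp s := foldr (fun n x => mul (i n) x) e s.
have lp_cat s t : lp (s ++ t) = mul (lp s) (lp t).
  by elim: s => [|n s IH]; rewrite /= ?mul1 // IH mulA.
have lp_surj x : exists s, lp s = x.
  have [n] := ubnP (sz x); elim: n x => // n IH x szx.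
  case: (pselect (x = e)) => [->|xe]; first by exists [::].
  case: (pselect (irred x)) => [/surj_i[k <-]|nirr].
    by exists [:: k]; rewrite /= mulC mul1.
  have [y [z [Ex ye ze]]] : exists y z, [/\ x = mul y z, y <> e & z <> e].
    apply: contrapT => H; apply: nirr; split=> // y z Ex.
    apply: contrapT => /not_orP[ye ze]; by apply: H; exists y, z.
  have gt1 w : w <> e -> 1 < sz w.
    move=> we; rewrite ltn_neqAle sz_gt0 andbT eq_sym.
    by apply/eqP=> /sz_eq1.
  have [s Es] : exists s, lp s = y.
    apply: IH; rewrite -ltnS; apply: leq_trans szx; rewrite ltnS Ex szM.
    by rewrite -{1}[sz y]muln1 ltn_pmul2l ?gt1.
  have [t Et] : exists s, lp s = z.
    apply: IH; rewrite -ltnS; apply: leq_trans szx; rewrite ltnS Ex szM.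
    by rewrite -{1}[sz z]mul1n ltn_pmul2r ?gt1.
  by exists (s ++ t); rewrite lp_cat Es Et.
have lp_rem n s : n \in s -> lp s = mul (i n) (lp (rem n s)).
  elim: s => //= k s IH; rewrite inE eq_sym; case: eqP => [->//|_] /=.
  by move/IH=> ->; rewrite /= !mulA [mul (i n) (i k)]mulC.
have lp_dvd n x s : mul (i n) x = lp s -> n \in s.
  elim: s x => [|k s IH] x /=.
    by case/mul_eqe=> ine; case: (irr_i n).
  case/(irred_dvd (irr_i n))=> [[y ik]|[y Ey]]; last first.
    by rewrite inE (IH y) ?orbT.
  case: (irr_i k) => _ /(_ _ _ ik)[ine|ye]; first by case: (irr_i n).
  by move: ik; rewrite ye mulC mul1 => /inj_i ->; rewrite mem_head.
have lp_inj s t : lp s = lp t -> perm_eq s t.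
  elim: s t => [|n s IH] t /=.
    case: t => // k t /= /esym/mul_eqe[ike _]; by case: (irr_i k).
  move=> E; have nt := lp_dvd _ _ _ E; move: E; rewrite (lp_rem _ _ nt).
  move/(irred_cancel (irr_i n))/IH => st.
  by rewrite perm_sym (perm_trans (perm_to_rem nt)) // perm_cons perm_sym.
pose mon s := \big[mmul/mone]_(n <- s) @ucm nat n.
have mon_count s n : mon s n = count_mem n s.
  rewrite /mon; elim: s => [|k s IH]; first by rewrite big_nil cm1.
  by rewrite big_cons cmM IH cmU /=.
have mon_perm s t : mon s = mon t <-> perm_eq s t.
  split=> [E|]; last exact: perm_big.
  by apply/allP=> n _ /=; rewrite -!mon_count E.
pose ls x := sval (cid (lp_surj x)).
have lsK x : lp (ls x) = x by rewrite /ls; case: cid.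
exists (fun x => mon (ls x)); split.
- have -> : ls e = [::].
    by apply/perm_small_eq; rewrite // lp_inj // lsK.
  by rewrite /mon big_nil.
- move=> x y; transitivity (mon (ls x ++ ls y)); last by rewrite /mon big_cat.
  by apply/mon_perm/lp_inj; rewrite lp_cat !lsK.
- move=> x y /mon_perm E; rewrite -(lsK x) -(lsK y).
  elim: (ls x) (ls y) E => [|n s IH] t.
    by rewrite perm_sym => /perm_nilP ->.
  move=> st; have nt : n \in t by rewrite -(perm_mem st) mem_head.
  rewrite (lp_rem _ _ nt) /= (IH (rem n t)) //.
  by rewrite -(perm_cons n) (perm_trans st) // perm_to_rem.
- move=> m; pose s := flatten [seq nseq (m n) n | n <- enum_fset (finsupp m)].
  exists (lp s); transitivity (mon s); first by apply/mon_perm/lp_inj.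
  apply/eqP/cmP => n; rewrite mon_count /s count_flatten -map_comp.
  have E k : (count_mem n \o (fun j => nseq (m j) j)) k = (k == n) * m k.
    by rewrite /= count_nseq.
  rewrite (eq_map E) sumnE big_map.
  case: (boolP (n \in finsupp m)) => nm.
    rewrite (bigD1_seq n) ?fset_uniq //= eqxx mul1n big1 ?addn0 //.
    by move=> k /negPf ->.
  rewrite big_seq big1 => [|k km].
    by move: nm; rewrite -cmE_eq0 => /eqP.
  by case: eqP => // kn; move: nm; rewrite -kn km.
Qed.

End FreeMonoid.

(** * Linear extension of a monoid isomorphism to monoid algebras *)

Section MonoidAlgebra.
Import GRing.Theory.
Local Open Scope ring_scope.
Variables (R : ringType) (K : choiceType) (L : monomType) (M : {pred K})
  (op : K -> K -> K) (one : K) (psi : K -> L).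

(** When [op] is a graph product followed by [canon], these are convertible to [supported_on] and
    [wmul], so the results apply to weighted graphs directly. *)
Let supp (x : {malg R[K]}) := all M (msupp x).
Let mulK (x y : {malg R[K]}) : {malg R[K]} :=
  \sum_(a <- msupp x) \sum_(b <- msupp y) << x@_a * y@_b *g op a b >>.

Let suppP x : reflect (forall k, x@_k != 0 -> M k) (supp x).
Proof.
apply: (iffP allP) => H k; first by rewrite mcoeff_neq0; apply: H.
by move=> kx; apply: H; rewrite mcoeff_neq0.
Qed.

Let suppU c k : M k -> supp << c *g k >>.
Proof.
move=> Mk; apply/suppP => l; rewrite mcoeffU.
by case: (eqVneq k l) => [<-//|_]; rewrite mulr0n eqxx.
Qed.

Let supp_sum (I : eqType) (r : seq I) (F : I -> {malg R[K]}) :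
  (forall i, i \in r -> supp (F i)) -> supp (\sum_(i <- r) F i).
Proof.
move=> H; rewrite big_seq; apply: (big_ind supp) => // [|x y].
  by apply/suppP => k; rewrite mcoeff0 eqxx.
move=> /suppP Hx /suppP Hy; apply/suppP => k.
rewrite mcoeffD; case: (eqVneq x@_k 0) => [->|/Hx//].
by rewrite add0r => /Hy.
Qed.

Hypotheses (M_op : forall a b, M a -> M b -> M (op a b))
  (psi_one : psi one = mone)
  (psi_op : forall a b, M a -> M b -> psi (op a b) = mmul (psi a) (psi b))
  (psi_inj : {in M &, injective psi})
  (psi_surj : forall m, exists2 x, M x & psi x = m).

Let f (x : {malg R[K]}) : {malg R[L]} := \sum_(k <- msupp x) << x@_k *g psi k >>.

(** Zero coefficients contribute nothing; summing over a common larger set lets [f x], [f y] and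
    [f (x + y)] be compared term by term. *)
Let fEw (d : {fset K}) x : (msupp x `<=` d)%fset ->
  f x = \sum_(k <- d) << x@_k *g psi k >>.
Proof.
move=> le; apply: big_fset_incl => //.
by move=> k _ /mcoeff_outdom ->; rewrite monalgU0.
Qed.

Let fD : {morph f : x y / x + y}.
Proof.
move=> x y; set d := (msupp x `|` msupp y)%fset.
rewrite (@fEw d (x + y)) ?msuppD_le // (@fEw d x) ?fsubsetUl //.
rewrite (@fEw d y) ?fsubsetUr // -big_split /=.
by apply: eq_bigr => k _; rewrite mcoeffD monalgUD.
Qed.

Let f0 : f 0 = 0.
Proof. by rewrite /f msupp0 big_nil. Qed.

Let fU c k : f << c *g k >> = << c *g psi k >>.
Proof. by rewrite (fEw msuppU_le) big_seq_fset1 mcoeffUU. Qed.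

Let f_sum (I : Type) (r : seq I) (F : I -> {malg R[K]}) :
  f (\sum_(i <- r) F i) = \sum_(i <- r) f (F i).
Proof. exact: (big_morph f fD f0). Qed.

Let f_coef x k : supp x -> M k -> (f x)@_(psi k) = x@_k.
Proof.
move=> /suppP Hx Mk; rewrite /f raddf_sum /=.
case: (boolP (k \in msupp x)) => kx.
  rewrite (bigD1_seq k) ?fset_uniq //= mcoeffUU big1_seq ?addr0 //.
  move=> l /andP[lk lx]; rewrite mcoeffU; case: eqP => // E.
  by move: lk; rewrite (psi_inj _ Mk E) ?eqxx // /in_mem /= Hx // mcoeff_neq0.
rewrite mcoeff_outdom // big1_seq // => l /= lx.
rewrite mcoeffU; case: eqP => // E.
by move: kx; rewrite -(psi_inj _ Mk E) ?lx // /in_mem /= Hx // mcoeff_neq0.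
Qed.

(** The map is the linear extension [f] of [psi]. As [psi] is controlled only on [M], products and
    injectivity concern elements supported on [M]. *)
Lemma monoid_algebra_iso :
  {in supp &, forall x y, supp (mulK x y)} /\
  exists F : {malg R[K]} -> {malg R[L]},
    [/\ {in supp &, forall x y, F (x + y) = F x + F y},
        {in supp &, forall x y, F (mulK x y) = F x * F y},
        F << one >> = 1,
        {in supp &, injective F} &
        forall r, exists2 x, supp x & F x = r].
Proof.
have M_supp x a : supp x -> a \in msupp x -> M a.
  by move=> /suppP Hx; rewrite -mcoeff_neq0; apply: Hx.
split=> [x y Hx Hy|].
  apply: supp_sum => a ax; apply: supp_sum => b bY; apply: suppU.
  by apply: M_op; [apply: (M_supp x)|apply: (M_supp y)].
exists f; split.
- by move=> x y _ _; apply: fD.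
- move=> x y Hx Hy; rewrite f_sum big_distrlr /=.
  apply: eq_big_seq => a ax; rewrite f_sum; apply: eq_big_seq => b bY.
  rewrite fU (psi_op (M_supp _ _ Hx ax) (M_supp _ _ Hy bY)).
  by rewrite malgM_def fgmulUU.
- by rewrite fU psi_one.
- move=> x y Hx Hy E; apply/malgP => k.
  case: (boolP (M k)) => Mk; first by rewrite -!f_coef // E.
  have nMk z : supp z -> z@_k = 0.
    by move=> /suppP Hz; apply/eqP; apply: contraNT Mk; apply: Hz.
  by rewrite !nMk.
- move=> r; have g m : {x | M x & psi x = m} by apply: cid2.
  exists (\sum_(m <- msupp r) << r@_m *g s2val (g m) >>).
    by apply: supp_sum => m _; apply: suppU; case: (g m).
  rewrite f_sum [RHS]monalgE; apply: eq_bigr => m _.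
  by rewrite fU; case: (g m) => /= k _ ->.
Qed.

End MonoidAlgebra.

Lemma ring_iso_of_monoid_iso (P : graph -> bool) (op : graph -> graph -> graph)
    (one : graph) (psi : graph -> {cmonom nat}) :
  let M k := (canon k == k) && P k in
  M one ->
  (forall a b, M a -> M b -> M (canon (op a b))) ->
  psi one = mone ->
  (forall a b, M a -> M b -> psi (canon (op a b)) = mmul (psi a) (psi b)) ->
  {in M &, injective psi} ->
  (forall m, exists2 x, M x & psi x = m) ->
  ring_iso_to_Zpoly P (wmul op) << one >>%R.
Proof.
move=> M M_one M_op psi1 psiM psi_inj psi_surj.
have [closed iso] :=
  @monoid_algebra_iso int graph {cmonom nat} M _ one psi M_op psi1 psiM
    psi_inj psi_surj.
split; [|exact: closed|exact: iso].
by apply/allP => k /(fsubsetP msuppU_le); rewrite inE => /eqP ->.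
Qed.

(** * Isomorphism classes of graphs *)

(** Stated for relations on arbitrary finite types, so that products, images and quotients need no
    numbering of vertices. *)
Definition iso (T1 T2 : finType) (r1 : rel T1) (r2 : rel T2) : Prop :=
  exists2 h : T1 -> T2, bijective h & forall x y, r2 (h x) (h y) = r1 x y.

Lemma iso_refl (T : finType) (r : rel T) : iso r r.
Proof. by exists id => //; exists id. Qed.

Lemma iso_sym (T1 T2 : finType) (r1 : rel T1) (r2 : rel T2) :
  iso r1 r2 -> iso r2 r1.
Proof.
move=> [h [g gK hK] hr]; exists g; first by exists h.
by move=> x y; rewrite -hr !hK.
Qed.

Lemma iso_trans (T1 T2 T3 : finType) (r1 : rel T1) (r2 : rel T2) (r3 : rel T3) :
  iso r1 r2 -> iso r2 r3 -> iso r1 r3.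
Proof.
move=> [h bh hr] [k bk kr]; exists (k \o h); first exact: bij_comp.
by move=> x y /=; rewrite kr hr.
Qed.

Lemma iso_card (T1 T2 : finType) (r1 : rel T1) (r2 : rel T2) :
  iso r1 r2 -> #|T1| = #|T2|.
Proof. by move=> [h /bij_eq_card]. Qed.

Lemma mkgraph_iso (T : finType) (r : rel T) : iso r (@adj (mkgraph r)).
Proof.
exists (@enum_rank T); first exact: enum_rank_bij.
by move=> x y; rewrite /adj /= ffunE /= !enum_rankK.
Qed.

Lemma canon_iso (G : graph) : iso (@adj G) (@adj (canon G)).
Proof.
rewrite /canon; case: pickP => [r /existsP[p /forallP pr]|_].
  exists (fun x => p x); first by exists (p^-1)%g => x; rewrite ?permK ?permKV.
  by move=> x y; have /forallP/(_ y)/eqP := pr x.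
exact: iso_refl.
Qed.

(** Composing with the isomorphism shows that the two searches in [canon] test the same predicate,
    so they pick the same relation. *)
Lemma iso_canon (G H : graph) : iso (@adj G) (@adj H) -> canon G = canon H.
Proof.
case: G H => n g [m k] i; have := iso_card i; rewrite !card_ord /= => E.
case: m / E k i => k [h bh hr].
pose s := perm (bij_inj bh).
have sE u v : k (s u, s v) = g (u, v) by rewrite !permE; apply: hr.
rewrite /canon /=.
have E : (fun r : {ffun 'I_n * 'I_n -> bool} => [exists p : {perm 'I_n}, forall u, forall v,
     g (u, v) == r (p u, p v)]) =1 (fun r => [exists p : {perm 'I_n}, forall u, forall v,
     k (u, v) == r (p u, p v)]).
  move=> r; apply/idP/idP => /existsP[p /forallP pr]; apply/existsP.
    exists (s^-1 * p)%g; apply/forallP => u; apply/forallP => v.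
    have /forallP/(_ ((s^-1)%g v))/eqP := pr ((s^-1)%g u).
    by rewrite -sE !permKV !permM => ->.
  exists (s * p)%g; apply/forallP => u; apply/forallP => v.
  have /forallP/(_ (s v))/eqP := pr (s u).
  by rewrite sE !permM => ->.
rewrite (eq_pick E); case: pickP => // /(_ k)/existsP[].
by exists 1%g; apply/forallP => u; apply/forallP => v; rewrite !perm1.
Qed.

Lemma canon_id (G : graph) : canon (canon G) = canon G.
Proof. exact/iso_canon/iso_sym/canon_iso. Qed.

Lemma canon_fixed_iso (G H : graph) :
  canon G = G -> canon H = H -> iso (@adj G) (@adj H) -> G = H.
Proof. by move=> cG cH i; rewrite -cG -cH (iso_canon i). Qed.

Lemma connect_map (T1 T2 : finType) (r1 : rel T1) (r2 : rel T2) (h : T1 -> T2) :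
  (forall x y, r1 x y -> connect r2 (h x) (h y)) ->
  forall x y, connect r1 x y -> connect r2 (h x) (h y).
Proof.
move=> H x y /connectP[p]; elim: p x => [|z p IH] x /=; first by move=> _ ->.
by move=> /andP[/H xz /IH pz] /pz; apply: connect_trans.
Qed.

(** * From refinement of a graph product to the ring isomorphism *)

Section RingOfRefinement.

Variables (prod : forall T1 T2 : finType, rel T1 -> rel T2 -> rel (T1 * T2)%type)
  (cls : forall T : finType, rel T -> Prop) (one : graph).
Hypotheses
  (prod_iso : forall (T1 T2 T1' T2' : finType) (r1 : rel T1) (r2 : rel T2)
     (r1' : rel T1') (r2' : rel T2'),
     iso r1 r1' -> iso r2 r2' -> iso (prod r1 r2) (prod r1' r2'))
  (prodC : forall (T1 T2 : finType) (r1 : rel T1) (r2 : rel T2),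
     iso (prod r1 r2) (prod r2 r1))
  (prodA : forall (T1 T2 T3 : finType) (r1 : rel T1) (r2 : rel T2) (r3 : rel T3),
     iso (prod r1 (prod r2 r3)) (prod (prod r1 r2) r3))
  (prod1 : forall (T : finType) (r : rel T), iso (prod (@adj one) r) r).
Hypotheses
  (cls_iso : forall (T1 T2 : finType) (r1 : rel T1) (r2 : rel T2),
     iso r1 r2 -> cls r1 -> cls r2)
  (cls_prod : forall (T1 T2 : finType) (r1 : rel T1) (r2 : rel T2),
     cls r1 -> cls r2 -> cls (prod r1 r2))
  (cls_one : cls (@adj one))
  (cls_card_gt0 : forall (T : finType) (r : rel T), cls r -> 0 < #|T|)
  (cls_card1 : forall (T : finType) (r : rel T), cls r -> #|T| = 1 ->
     iso (@adj one) r)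
  (cls_card_surj : forall n, 0 < n -> exists r : rel 'I_n, cls r).
Hypothesis refinement : forall (A B C D : finType)
    (rA : rel A) (rB : rel B) (rC : rel C) (rD : rel D),
  cls rA -> cls rB -> cls rC -> cls rD ->
  iso (prod rA rB) (prod rC rD) ->
  exists (P Q S T : finType) (rP : rel P) (rQ : rel Q) (rS : rel S) (rT : rel T),
    [/\ cls rP, cls rQ, cls rS & cls rT] /\
    [/\ iso rA (prod rP rQ), iso rB (prod rS rT), iso rC (prod rP rS) &
        iso rD (prod rQ rT)].
Variables (P : graph -> bool) (op : graph -> graph -> graph).
Hypotheses (P_cls : forall G, P G <-> cls (@adj G))
  (opE : forall G H, op G H = mkgraph (prod (@adj G) (@adj H)))
  (canon_one : canon one = one).

Let M (G : graph) := (canon G == G) && P G.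
(** Isomorphism classes, each represented by its canonical graph; as a subtype of [graph] this is
    countable, as [free_comm_monoid] demands. *)
Let K := {G : graph | M G}.

Let canon_of (T : finType) (r : rel T) : graph := canon (mkgraph r).

Let canon_of_iso (T : finType) (r : rel T) : iso r (@adj (canon_of r)).
Proof. by apply: iso_trans (mkgraph_iso r) _; apply: canon_iso. Qed.

Let M_canon_of (T : finType) (r : rel T) : cls r -> M (canon_of r).
Proof.
move=> cr; rewrite /M canon_id eqxx /=; apply/P_cls.
by apply: cls_iso cr; apply: canon_of_iso.
Qed.

Let cls_K (x : K) : cls (@adj (sval x)).
Proof. by apply/P_cls; case: x => G /= /andP[]. Qed.

Let K_eq (x y : K) : iso (@adj (sval x)) (@adj (sval y)) -> x = y.
Proof.
move=> i; apply: val_inj; apply: canon_fixed_iso i.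
  by case: x => G /= /andP[/eqP].
by case: y => G /= /andP[/eqP].
Qed.

Let M_op G H : M G -> M H -> M (canon (op G H)).
Proof.
move=> /andP[_ PG] /andP[_ PH]; rewrite opE.
by apply: M_canon_of; apply: cls_prod; apply/P_cls.
Qed.

Let M_one : M one.
Proof. by rewrite /M canon_one eqxx; apply/P_cls. Qed.

Let kone : K := exist (fun G => M G) one M_one.
Let kmul (x y : K) : K := exist (fun G => M G) _ (M_op (svalP x) (svalP y)).
Let kof (T : finType) (r : rel T) (cr : cls r) : K := exist (fun G => M G) _ (M_canon_of cr).

Let kmul_iso (x y : K) :
  iso (prod (@adj (sval x)) (@adj (sval y))) (@adj (sval (kmul x y))).
Proof. by rewrite /= opE; apply: canon_of_iso. Qed.

Let kmul_iso' (x y : K) (T1 T2 : finType) (r1 : rel T1) (r2 : rel T2) :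
  iso r1 (@adj (sval x)) -> iso r2 (@adj (sval y)) ->
  iso (prod r1 r2) (@adj (sval (kmul x y))).
Proof. by move=> i1 i2; apply: iso_trans (kmul_iso x y); apply: prod_iso. Qed.

Let tag_card G : tag G = #|V G|.
Proof. by rewrite card_ord. Qed.

(** The classes form a commutative monoid under [kmul] with the number of vertices as size, which is
    multiplicative, equals 1 only at the unit and takes every positive value; [free_comm_monoid]
    then applies. *)
Theorem ring_iso_of_refinement : ring_iso_to_Zpoly P (wmul op) << one >>%R.
Proof.
have mulA : associative kmul.
  move=> x y z; apply: K_eq.
  apply: iso_trans (iso_sym (kmul_iso' (iso_refl _) (kmul_iso y z))) _.
  apply: iso_trans (prodA _ _ _) _.
  exact: kmul_iso' (kmul_iso x y) (iso_refl _).
have mulC : commutative kmul.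
  move=> x y; apply: K_eq; apply: iso_trans (iso_sym (kmul_iso _ _)) _.
  by apply: iso_trans (prodC _ _) (kmul_iso _ _).
have mul1 : left_id kone kmul.
  move=> x; apply: K_eq; apply: iso_trans (iso_sym (kmul_iso _ _)) _.
  exact: prod1.
pose sz (x : K) := tag (sval x).
have szE x : sz x = #|V (sval x)| by apply: tag_card.
have szM x y : sz (kmul x y) = sz x * sz y.
  by rewrite !szE -(iso_card (kmul_iso x y)) card_prod.
have sz_gt0 x : 0 < sz x by rewrite szE; apply: cls_card_gt0 (cls_K x).
have sz_eq1 x : sz x = 1 -> x = kone.
  rewrite szE => c1; apply: K_eq; apply: iso_sym.
  exact: cls_card1 (cls_K x) c1.
have sz_surj n : 0 < n -> exists x, sz x = n.
  move=> /cls_card_surj[r cr]; exists (kof cr).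
  by rewrite szE -(iso_card (canon_of_iso r)) card_ord.
have refine a b c d : kmul a b = kmul c d -> exists p q s t,
    [/\ a = kmul p q, b = kmul s t, c = kmul p s & d = kmul q t].
  move=> E.
  have /refinement : iso (prod (@adj (sval a)) (@adj (sval b)))
                         (prod (@adj (sval c)) (@adj (sval d))).
    by apply: iso_trans (kmul_iso a b) _; rewrite E; apply/iso_sym/kmul_iso.
  case/(_ (cls_K a) (cls_K b) (cls_K c) (cls_K d)).
  move=> P0 [Q [S [T [rP [rQ [rS [rT [[cP cQ cS cT] [iA iB iC iD]]]]]]]]].
  have E2 (x : K) (T1 T2 : finType) (r1 : rel T1) (r2 : rel T2)
      (c1 : cls r1) (c2 : cls r2) :
      iso (@adj (sval x)) (prod r1 r2) -> x = kmul (kof c1) (kof c2).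
    move=> i; apply: K_eq; apply: iso_trans i _.
    by apply: kmul_iso'; apply: canon_of_iso.
  exists (kof cP), (kof cQ), (kof cS), (kof cT).
  by split; apply: E2.
have [psi [psi1 psiM psi_inj psi_surj]] :=
  free_comm_monoid mulA mulC mul1 szM sz_gt0 sz_eq1 sz_surj refine.
(* [psi] lives on the subtype [K]; outside [M] the value [mone] is a placeholder. *)
pose psi' (G : graph) := if insub G is Some x then psi x else mone.
have psi'E (x : K) : psi' (sval x) = psi x by rewrite /psi' valK.
have psi'M G (MG : M G) : psi' G = psi (exist _ G MG) by rewrite -psi'E.
apply: (@ring_iso_of_monoid_iso P op one psi' M_one M_op).
- by rewrite (psi'M _ M_one).
- move=> a b Ma Mb; rewrite (psi'M _ Ma) (psi'M _ Mb) -psiM -psi'E.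
  by congr (psi' _).
- move=> a b Ma Mb; rewrite (psi'M _ Ma) (psi'M _ Mb).
  by move/psi_inj => [].
- move=> m; have [x <-] := psi_surj m.
  by exists (sval x); [exact: (svalP x)|exact: psi'E].
Qed.

End RingOfRefinement.

(** * Strict refinement from a multiplicative metric *)

Section StrictRefinement.
Import Order.TTheory GRing.Theory Num.Theory.
Local Open Scope ring_scope.

(** With [d = -log s] this is a metric, possibly asymmetric, with finite distances; the last clause
    is the triangle inequality. The multiplicative form stays inside an ordered field. *)
Definition similarity (R : realFieldType) (T : Type) (s : T -> T -> R) : Prop :=
  [/\ forall x, s x x = 1, forall x y, 0 < s x y <= 1,
      forall x y, s x y = 1 -> x = y &
      forall x y z, s x y * s y z <= s x z].

Section Commutation.
Variables (R : realFieldType) (X A B C D : Type).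
Variables (a : X -> A) (b : X -> B) (c : X -> C) (d : X -> D) (f g : X -> X -> X).
Hypotheses (ab_inj : forall x y, a x = a y -> b x = b y -> x = y)
  (cd_inj : forall x y, c x = c y -> d x = d y -> x = y)
  (af : forall x y, a (f x y) = a x) (bf : forall x y, b (f x y) = b y)
  (cg : forall x y, c (g x y) = c x) (dg : forall x y, d (g x y) = d y).
Variables (sA : A -> A -> R) (sB : B -> B -> R) (sC : C -> C -> R)
  (sD : D -> D -> R).
Hypotheses (simA : similarity sA) (simB : similarity sB) (simC : similarity sC)
  (simD : similarity sD).
Hypothesis sABCD : forall x y,
  sA (a x) (a y) * sB (b x) (b y) = sC (c x) (c y) * sD (d x) (d y).

(** The point [m = f x y] satisfies [s(x, m) s(m, y) = s(x, y)], so it lies between [x] and [y].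
    When [c x = c y], the right side is its [D]-part, and the triangle inequality for [sD] leaves no
    room for [sC (c x) (c m) < 1]. *)
Let between_c x y : c x = c y -> c (f x y) = c x.
Proof.
case: simA simB simC simD => [A1 A01 A2 A3] [B1 _ B2 B3] [C1 C01 C2 C3] [D1 D01 D2 D3].
move=> cxy; set m := f x y.
have E : sC (c x) (c m) * sD (d x) (d m) * (sC (c m) (c y) * sD (d m) (d y)) =
         sD (d x) (d y).
  by rewrite -!sABCD /m !af !bf A1 B1 mul1r mulr1 mulrC sABCD cxy C1 mul1r.
have /andP[d0 _] := D01 (d x) (d y).
have /andP[c0 c1] := C01 (c x) (c m).
have /andP[c0' c1'] := C01 (c m) (c y).
apply/esym/C2/eqP; rewrite eq_le c1 /=.
apply: le_trans (_ : sC (c x) (c m) * sC (c m) (c y) <= _); last first.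
  by rewrite ler_piMr // ltW.
rewrite -(ler_pM2r d0) mul1r -{1}E mulrACA ler_pM2l ?D3 ?mulr_gt0 //.
Qed.

Let between_d x y : d x = d y -> d (f x y) = d x.
Proof.
case: simA simB simC simD => [A1 A01 A2 A3] [B1 _ B2 B3] [C1 C01 C2 C3] [D1 D01 D2 D3].
move=> dxy; set m := f x y.
have E : sC (c x) (c m) * sD (d x) (d m) * (sC (c m) (c y) * sD (d m) (d y)) =
         sC (c x) (c y).
  by rewrite -!sABCD /m !af !bf A1 B1 mul1r mulr1 mulrC sABCD dxy D1 mulr1.
have /andP[c0 _] := C01 (c x) (c y).
have /andP[d0 d1] := D01 (d x) (d m).
have /andP[d0' d1'] := D01 (d m) (d y).
apply/esym/D2/eqP; rewrite eq_le d1 /=.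
apply: le_trans (_ : sD (d x) (d m) * sD (d m) (d y) <= _); last first.
  by rewrite ler_piMr // ltW.
rewrite -(ler_pM2l c0) mulr1 -{1}E mulrACA ler_pM2r ?C3 ?mulr_gt0 //.
Qed.

(** The points [w] and [v] have the same [b]-coordinate as [m = f x v], so their similarity to [m]
    lies purely in [A]. Evaluated through [C] and [D], both have the same [D]-factor, and
    [c v = c m], so they differ by the [C]-factor of [w]. *)
Let exchange x y z : a x = a y ->
  sA (a (g x z)) (a x) =
  sC (c (f (g x z) (g y z))) (c y) * sA (a (g y z)) (a x).
Proof.
case: simA simB simC simD => [A1 A01 A2 A3] [B1 _ B2 B3] [C1 C01 C2 C3] [D1 D01 D2 D3].
move=> axy; set u := g x z; set v := g y z; set w := f u v.
pose m := f x v.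
have cm : c m = c y.
  have -> : m = f y v by apply: ab_inj; rewrite !(af, bf).
  by apply: between_c; rewrite /v cg.
have dw : d w = d v by rewrite between_d /u /v !dg.
have := sABCD w m; rewrite /w /m !af !bf -/w -/m B1 mulr1 => ->.
have := sABCD v m; rewrite /m af bf -/m B1 mulr1 => ->.
by rewrite cm dw /v cg C1 mul1r.
Qed.

(** [exchange], applied to [x, y] and to [y, x], gives inequalities both ways between the two
    similarities to [a x]. Equality makes the [C]-factor 1, hence [w = v], and [w] has the
    [a]-coordinate of [g x z]. *)
Lemma coordinate_commutes x y z : a x = a y -> a (g x z) = a (g y z).
Proof.
case: simA simB simC simD => [A1 A01 A2 A3] [B1 _ B2 B3] [C1 C01 C2 C3] [D1 D01 D2 D3].
move=> axy; set u := g x z; set v := g y z; set w := f u v.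
have E1 := exchange z axy; have E2 := exchange z (esym axy).
rewrite -/u -/v -/w in E1 E2; rewrite -axy in E2.
have le s t : 0 < s -> 0 < t <= 1 -> t * s <= s :> R.
  by move=> s0 /andP[t0 t1]; rewrite ler_piMl // ltW.
have /andP[u0 _] := A01 (a u) (a x); have /andP[v0 _] := A01 (a v) (a x).
have E : sA (a u) (a x) = sA (a v) (a x).
  by apply/le_anti/andP; split; [rewrite E1 le|rewrite E2 le].
have cw : c w = c v.
  rewrite [in RHS]/v cg; apply: C2; move: E1; rewrite E -{1}[sA _ _]mul1r.
  by move/(mulIf (lt0r_neq0 v0)).
have dw : d w = d v by rewrite between_d /u /v !dg.
by rewrite -(af u v) -/w (cd_inj cw dw).
Qed.

End Commutation.

Variables (R : realFieldType) (X : finType) (A B C D : Type).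
Variables (a : X -> A) (b : X -> B) (c : X -> C) (d : X -> D) (f g : X -> X -> X).
Hypotheses (ab_inj : forall x y, a x = a y -> b x = b y -> x = y)
  (cd_inj : forall x y, c x = c y -> d x = d y -> x = y)
  (af : forall x y, a (f x y) = a x) (bf : forall x y, b (f x y) = b y)
  (cg : forall x y, c (g x y) = c x) (dg : forall x y, d (g x y) = d y).
Variables (sA : A -> A -> R) (sB : B -> B -> R) (sC : C -> C -> R)
  (sD : D -> D -> R).
Hypotheses (simA : similarity sA) (simB : similarity sB) (simC : similarity sC)
  (simD : similarity sD).
Hypothesis sABCD : forall x y,
  sA (a x) (a y) * sB (b x) (b y) = sC (c x) (c y) * sD (d x) (d y).
Variable o : X.

Let ag x y x' y' : a x = a x' -> a y = a y' -> a (g x y) = a (g x' y').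
Proof.
move=> ax ay; transitivity (a (g x' y)).
  exact: (coordinate_commutes ab_inj cd_inj af bf cg dg simA simB simC simD).
(* Reversing the arguments of [g] swaps the roles of [C] and [D], which treats the second
   argument. *)
apply: (@coordinate_commutes R X A B D C a b d c f (fun x y => g y x) _ _
  _ _ _ _ sA sB sD sC) => //; first by move=> ? ? ? ?; apply: cd_inj.
by move=> ? ?; rewrite sABCD mulrC.
Qed.

Let bg x y x' y' : b x = b x' -> b y = b y' -> b (g x y) = b (g x' y').
Proof.
move=> bx bY; transitivity (b (g x' y)).
  apply: (@coordinate_commutes R X B A C D b a c d (fun x y => f y x) g _ _
    _ _ _ _ sB sA sC sD) => //; first by move=> ? ? ? ?; apply: ab_inj.
  by move=> ? ?; rewrite -sABCD mulrC.
apply: (@coordinate_commutes R X B A D C b a d c (fun x y => f y x)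
  (fun x y => g y x) _ _ _ _ _ _ sB sA sD sC) => //.
- by move=> ? ? ? ?; apply: ab_inj.
- by move=> ? ? ? ?; apply: cd_inj.
- by move=> ? ?; rewrite mulrC sABCD mulrC.
Qed.

(** Both sides have equal [a]- and [b]-coordinates by [ag] and [bg]. This interchange law says that
    the two decompositions commute, and it yields the counterparts [cf] and [df]. *)
Let fg x x' y y' : f (g x x') (g y y') = g (f x y) (f x' y').
Proof.
apply: ab_inj; rewrite !(af, bf).
  by apply: ag; rewrite af.
by apply: bg; rewrite bf.
Qed.

Let cf x y x' y' : c x = c x' -> c y = c y' -> c (f x y) = c (f x' y').
Proof.
move=> cx cy; rewrite -(cg (f x y) (f x' y')) -fg.
have -> : g x x' = x' by apply: cd_inj; rewrite !(cg, dg).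
by have -> : g y y' = y' by apply: cd_inj; rewrite !(cg, dg).
Qed.

Let df x y x' y' : d x = d x' -> d y = d y' -> d (f x y) = d (f x' y').
Proof.
move=> dx dy; rewrite -(dg (f x' y') (f x y)) -fg.
have -> : g x' x = x' by apply: cd_inj; rewrite !(cg, dg).
by have -> : g y' y = y' by apply: cd_inj; rewrite !(cg, dg).
Qed.

Let im (h : X -> X) : finType := seq_sub (codom h).
Let to_im (h : X -> X) (x : X) : im h := SeqSub (codom_f h x).
Let to_imE h x y : to_im h x = to_im h y <-> h x = h y.
Proof. by split=> [[]//|E]; apply: val_inj. Qed.

Let to_im_surj h (u : im h) : exists x, to_im h x = u.
Proof.
by case: u => y hy; have /codomP[x E] := hy; exists x; apply: val_inj.
Qed.

(** The point taking its [A]-[C] part from [x], its [B]-[C] part from [y], its [A]-[D] part from [p]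
    and its [B]-[D] part from [q]. *)
Let cell x y p q := g (f x y) (f p q).

Let a_cell x y p q : a (cell x y p q) = a (g x p).
Proof. by apply: ag; rewrite af. Qed.
Let b_cell x y p q : b (cell x y p q) = b (g y q).
Proof. by apply: bg; rewrite bf. Qed.
Let c_cell x y p q : c (cell x y p q) = c (f x y).
Proof. by rewrite cg. Qed.
Let d_cell x y p q : d (cell x y p q) = d (f p q).
Proof. by rewrite dg. Qed.

(* [cell x o o o] keeps from [x] exactly what is determined by both the [a]-
   and the [c]-coordinate; moving [x] to another slot gives the other three. *)
Theorem strict_refinement :
  exists (P Q S T : finType) (p : X -> P) (q : X -> Q) (s : X -> S) (t : X -> T),
  [/\ forall x y, a x = a y <-> p x = p y /\ q x = q y,
      forall x y, b x = b y <-> s x = s y /\ t x = t y,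
      forall x y, c x = c y <-> p x = p y /\ s x = s y &
      forall x y, d x = d y <-> q x = q y /\ t x = t y] /\
  forall u v w r, exists x, [/\ p x = u, q x = v, s x = w & t x = r].
Proof.
pose hp x := cell x o o o; pose hq x := cell o o x o.
pose hs x := cell o x o o; pose ht x := cell o o o x.
(* The [b]-coordinate of [hp x] does not depend on [x], so [a] alone decides equality; likewise [c]
   alone does in [pE'], as [d] is constant. *)
have pE x y : hp x = hp y <-> a (g x o) = a (g y o).
  split=> [/(congr1 a)|E]; first by rewrite !a_cell.
  by apply: ab_inj; rewrite ?a_cell ?b_cell.
have qE x y : hq x = hq y <-> a (g o x) = a (g o y).
  split=> [/(congr1 a)|E]; first by rewrite !a_cell.
  by apply: ab_inj; rewrite ?a_cell ?b_cell.
have sE x y : hs x = hs y <-> b (g x o) = b (g y o).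
  split=> [/(congr1 b)|E]; first by rewrite !b_cell.
  by apply: ab_inj; rewrite ?a_cell ?b_cell.
have tE x y : ht x = ht y <-> b (g o x) = b (g o y).
  split=> [/(congr1 b)|E]; first by rewrite !b_cell.
  by apply: ab_inj; rewrite ?a_cell ?b_cell.
have pE' x y : hp x = hp y <-> c (f x o) = c (f y o).
  split=> [/(congr1 c)|E]; first by rewrite !c_cell.
  by apply: cd_inj; rewrite ?c_cell ?d_cell.
have qE' x y : hq x = hq y <-> d (f x o) = d (f y o).
  split=> [/(congr1 d)|E]; first by rewrite !d_cell.
  by apply: cd_inj; rewrite ?c_cell ?d_cell.
have sE' x y : hs x = hs y <-> c (f o x) = c (f o y).
  split=> [/(congr1 c)|E]; first by rewrite !c_cell.
  by apply: cd_inj; rewrite ?c_cell ?d_cell.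
have tE' x y : ht x = ht y <-> d (f o x) = d (f o y).
  split=> [/(congr1 d)|E]; first by rewrite !d_cell.
  by apply: cd_inj; rewrite ?c_cell ?d_cell.
exists (im hp), (im hq), (im hs), (im ht).
exists (to_im hp), (to_im hq), (to_im hs), (to_im ht).
have gg x : g (g x o) (g o x) = x by apply: cd_inj; rewrite !(cg, dg).
have ff x : f (f x o) (f o x) = x by apply: ab_inj; rewrite !(af, bf).
split.
  split=> x y; rewrite !to_imE.
  - rewrite pE qE; split=> [E|[E1 E2]]; first by split; apply: ag.
    by rewrite -(gg x) -(gg y); apply: ag.
  - rewrite sE tE; split=> [E|[E1 E2]]; first by split; apply: bg.
    by rewrite -(gg x) -(gg y); apply: bg.
  - rewrite pE' sE'; split=> [E|[E1 E2]]; first by split; apply: cf.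
    by rewrite -(ff x) -(ff y); apply: cf.
  - rewrite qE' tE'; split=> [E|[E1 E2]]; first by split; apply: df.
    by rewrite -(ff x) -(ff y); apply: df.
move=> u v w r.
have [x1 <-] := to_im_surj u; have [x2 <-] := to_im_surj v.
have [x3 <-] := to_im_surj w; have [x4 <-] := to_im_surj r.
(* The slots of [cell] are ordered P, S, Q, T, whence [x3] before [x2]. *)
exists (cell x1 x3 x2 x4); split; apply/to_imE.
- rewrite pE; transitivity (a (g (g x1 x2) o)).
    by apply: ag; rewrite ?a_cell.
  by congr a; apply: cd_inj; rewrite !(cg, dg).
- rewrite qE; transitivity (a (g o (g x1 x2))).
    by apply: ag; rewrite ?a_cell.
  by congr a; apply: cd_inj; rewrite !(cg, dg).
- rewrite sE; transitivity (b (g (g x3 x4) o)).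
    by apply: bg; rewrite ?b_cell.
  by congr b; apply: cd_inj; rewrite !(cg, dg).
- rewrite tE; transitivity (b (g o (g x3 x4))).
    by apply: bg; rewrite ?b_cell.
  by congr b; apply: cd_inj; rewrite !(cg, dg).
Qed.

End StrictRefinement.

(** * Largest walk weights as a multiplicative metric *)

Section WalkSimilarity.
Import Order.TTheory GRing.Theory Num.Theory.
Local Open Scope ring_scope.
Variable R : realFieldType.

Definition step_similarity (T : finType) (s : T -> T -> R) : Prop :=
  [/\ forall x, s x x = 1, forall x y, 0 <= s x y <= 1,
      forall x y, s x y = 1 -> x = y &
      forall x y, connect (fun x y => 0 < s x y) x y].

Fixpoint walk_weight (T : Type) (s : T -> T -> R) (x : T) (p : seq T) : R :=
  if p is y :: p' then s x y * walk_weight s y p' else 1.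

Definition walk_sup (T : Type) (s D : T -> T -> R) : Prop :=
  (forall x p, walk_weight s x p <= D x (last x p)) /\
  (forall x y, exists2 p, last x p = y & walk_weight s x p = D x y).

Lemma walk_weight_cat (T : Type) (s : T -> T -> R) x p1 p2 :
  walk_weight s x (p1 ++ p2) =
  walk_weight s x p1 * walk_weight s (last x p1) p2.
Proof. by elim: p1 x => [|y p1 IH] x /=; rewrite ?mul1r // IH mulrA. Qed.

Section Step.
Variables (T : finType) (s : T -> T -> R).
Hypothesis step_s : step_similarity s.

Lemma walk_weight01 x p : 0 <= walk_weight s x p <= 1.
Proof.
case: step_s => _ s01 _ _; elim: p x => [|y p IH] x /=; first by rewrite ler01 lexx.
have /andP[s0 s1] := s01 x y; have /andP[w0 w1] := IH y.
by rewrite mulr_ge0 //= mulr_ile1.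
Qed.

(** Cutting out a closed detour drops factors that are at most 1, so the weight does not
    decrease. *)
Lemma walk_weight_shorten x p : exists p',
  [/\ uniq (x :: p'), last x p' = last x p & walk_weight s x p <= walk_weight s x p'].
Proof.
elim: p x => [|y p IH] x /=; first by exists [::].
have [p1 [up1 l1 le1]] := IH y.
have /andP[s0 s1] : 0 <= s x y <= 1 by case: step_s.
have /andP[w0 w1] := walk_weight01 y p.
have le2 : s x y * walk_weight s y p <= walk_weight s x (y :: p1).
  by rewrite /= ler_wpM2l.
case: (boolP (x \in y :: p1)) => [|xp]; last first.
  by exists (y :: p1); split=> //; rewrite cons_uniq xp.
move=> xp; have [l [r E]] : exists l r, y :: p1 = l ++ x :: r.
  by case/splitPr: xp => l r; exists l, r.
exists r; split.
- by move: up1; rewrite E cat_uniq => /and3P[].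
- have -> : last x r = last x (y :: p1) by rewrite E last_cat.
  by rewrite /= l1.
apply: le_trans le2 _; rewrite E -cat_rcons walk_weight_cat last_rcons.
have /andP[? ?] := walk_weight01 x (rcons l x).
have /andP[? ?] := walk_weight01 x r.
by rewrite ler_piMl.
Qed.

(** By shortening, walks of length at most [#|T|] dominate all others, and among these finitely many
    a maximum exists. *)
Lemma walk_sup_exists : exists D, walk_sup s D.
Proof.
have H x y : exists v, (forall p, last x p = y -> walk_weight s x p <= v) /\
    exists2 p, last x p = y & walk_weight s x p = v.
  have card1 : (size [:: y] <= #|T|)%N by apply/card_gt0P; exists y.
  pose p0 : #|T|.-bseq T := Bseq card1.
  have P0 : [pred p : #|T|.-bseq T | last x p == y] p0 by exact: eqxx.
  case: (Order.TotalTheory.arg_maxP (fun p : #|T|.-bseq T => walk_weight s x p) P0).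
  move=> p /eqP lp max_p; exists (walk_weight s x p); split; last by exists p.
  move=> q lq; have [q' [uq' lq' le]] := walk_weight_shorten x q.
  have sq' : (size q' <= #|T|)%N.
    by have := max_card (mem (x :: q')); rewrite (card_uniqP uq'); apply: ltnW.
  apply: le_trans le (max_p (Bseq sq') _).
  by rewrite /= lq' lq.
pose D x y := sval (cid (H x y)).
have HD x y := svalP (cid (H x y)); rewrite -/(D _ _) in HD.
exists D; split=> [x p|x y]; last by case: (HD x y).
by have [le _] := HD x (last x p); apply: le.
Qed.

(** Connectedness gives positivity, and concatenating walks gives the triangle inequality. A product
    of numbers in [0, 1] equal to 1 has all factors 1, so a walk of weight 1 never moves. *)
Lemma walk_sup_similarity D : walk_sup s D -> similarity D.
Proof.
case: step_s => s1 s01 sinj sconn [leD exD].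
have D1 x y : D x y <= 1.
  by have [p _ <-] := exD x y; case/andP: (walk_weight01 x p).
split.
- by move=> x; apply/le_anti; rewrite D1 /=; apply: (leD x [::]).
- move=> x y; rewrite D1 andbT.
  have /connectP[p pp ->] := sconn x y; apply: lt_le_trans (leD x p).
  elim: p x pp => [|z p IH] x /=; first by rewrite ltr01.
  by case/andP=> xz /IH zp; rewrite mulr_gt0.
- move=> x y; have [p <- <-] := exD x y.
  elim: p x => [|z p IH] x //= E.
  have /andP[w0 w1] := walk_weight01 z p; have /andP[xz0 xz1] := s01 x z.
  have xz : s x z = 1.
    by apply/le_anti; rewrite xz1 /= -E ler_piMr.
  by move: E; rewrite xz mul1r => /IH; rewrite (sinj _ _ xz).
- move=> x y z; have [p lp <-] := exD x y; have [q lq <-] := exD y z.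
  have := leD x (p ++ q); rewrite walk_weight_cat last_cat lp lq.
  by [].
Qed.

End Step.

(** A walk in [X] projects to both factors, which bounds [DX] above. For the lower bound, walk first
    along [A] with the [B]-coordinate fixed, then along [B]; hence exact weights are asked only for
    steps along one coordinate. *)
Lemma walk_sup_prod (X A B : finType) (a : X -> A) (b : X -> B) (m : A -> B -> X)
    (sX : X -> X -> R) (sA : A -> A -> R) (sB : B -> B -> R) DX DA DB :
  step_similarity sA -> step_similarity sB -> step_similarity sX ->
  (forall u v, a (m u v) = u) -> (forall u v, b (m u v) = v) ->
  (forall x, m (a x) (b x) = x) ->
  (forall x y, sX x y <= sA (a x) (a y) * sB (b x) (b y)) ->
  (forall u u' v, sX (m u v) (m u' v) = sA u u') ->
  (forall u v v', sX (m u v) (m u v') = sB v v') ->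
  walk_sup sX DX -> walk_sup sA DA -> walk_sup sB DB ->
  forall x y, DX x y = DA (a x) (a y) * DB (b x) (b y).
Proof.
move=> stA stB stX am bm mab leX sXA sXB [leDX exDX] [leDA exDA] [leDB exDB] x y.
apply/le_anti/andP; split.
  have [p <- <-] := exDX x y; rewrite -(last_map a) -(last_map b).
  apply: le_trans (ler_pM _ _ (leDA _ _) (leDB _ _)).
  - elim: p x => [|z p IH] x /=; first by rewrite mulr1.
    rewrite mulrACA; apply: ler_pM (leX x z) (IH z).
      by case: stX => _ /(_ x z)/andP[].
    by case/andP: (walk_weight01 stX z p).
  - by case/andP: (walk_weight01 stA (a x) (map a p)).
  - by case/andP: (walk_weight01 stB (b x) (map b p)).
have [p lp wp] := exDA (a x) (a y); have [q lq wq] := exDB (b x) (b y).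
have wA u v r : walk_weight sX (m u v) (map (m^~ v) r) = walk_weight sA u r.
  by elim: r u => //= u' r IH u; rewrite IH sXA.
have wB u v r : walk_weight sX (m u v) (map (m u) r) = walk_weight sB v r.
  by elim: r v => //= v' r IH v; rewrite IH sXB.
have lA : last x (map (m^~ (b x)) p) = m (a y) (b x).
  by rewrite -{1}(mab x) last_map lp.
have := leDX x (map (m^~ (b x)) p ++ map (m (a y)) q).
rewrite walk_weight_cat last_cat lA wB -{1}(mab x) wA wp wq.
by rewrite last_map lq mab.
Qed.

(** The weights [sX] are compatible with both decompositions, so their walk similarity factors both
    as [DA DB] and as [DC DD], which is what [strict_refinement] asks for. *)
Theorem refinement_of_steps (A B C D : finType) (h : A * B -> C * D) (k : C * D -> A * B)
    (sX : A * B -> A * B -> R)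
    (sA : A -> A -> R) (sB : B -> B -> R) (sC : C -> C -> R) (sD : D -> D -> R) :
  cancel h k -> cancel k h -> A * B ->
  step_similarity sA -> step_similarity sB ->
  step_similarity sC -> step_similarity sD -> step_similarity sX ->
  (forall x y, sX x y <= sA x.1 y.1 * sB x.2 y.2) ->
  (forall u u' v, sX (u, v) (u', v) = sA u u') ->
  (forall u v v', sX (u, v) (u, v') = sB v v') ->
  (forall x y, sX x y <= sC (h x).1 (h y).1 * sD (h x).2 (h y).2) ->
  (forall u u' v, sX (k (u, v)) (k (u', v)) = sC u u') ->
  (forall u v v', sX (k (u, v)) (k (u, v')) = sD v v') ->
  exists (P Q S T : finType) (p : A * B -> P) (q : A * B -> Q) (s : A * B -> S)
    (t : A * B -> T),
  [/\ forall x y, x.1 = y.1 <-> p x = p y /\ q x = q y,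
      forall x y, x.2 = y.2 <-> s x = s y /\ t x = t y,
      forall x y, (h x).1 = (h y).1 <-> p x = p y /\ s x = s y &
      forall x y, (h x).2 = (h y).2 <-> q x = q y /\ t x = t y] /\
  forall u v w r, exists x, [/\ p x = u, q x = v, s x = w & t x = r].
Proof.
move=> hK kH o stA stB stC stD stX leAB sXA sXB leCD sXC sXD.
have [DX supX] := walk_sup_exists stX.
have [DA supA] := walk_sup_exists stA; have [DB supB] := walk_sup_exists stB.
have [DC supC] := walk_sup_exists stC; have [DD supD] := walk_sup_exists stD.
have EAB := @walk_sup_prod _ _ _ (fun x => x.1) (fun x => x.2) (fun u v => (u, v))
  _ _ _ _ _ _ stA stB stX _ _ _ leAB sXA sXB supX supA supB.
have ECD := @walk_sup_prod _ _ _ (fun x => (h x).1) (fun x => (h x).2)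
  (fun u v => k (u, v)) _ _ _ _ _ _ stC stD stX _ _ _ leCD sXC sXD supX supC supD.
apply: (@strict_refinement R _ A B C D (fun x => x.1) (fun x => x.2)
  (fun x => (h x).1) (fun x => (h x).2) (fun x y => (x.1, y.2))
  (fun x y => k ((h x).1, (h y).2)) _ _ _ _ _ _ DA DB DC DD) => //.
- by move=> [? ?] [? ?] /= -> ->.
- move=> x y E1 E2; apply: (can_inj hK).
  by rewrite [LHS]surjective_pairing E1 E2 -surjective_pairing.
- by move=> x y; rewrite kH.
- by move=> x y; rewrite kH.
- exact: walk_sup_similarity supA.
- exact: walk_sup_similarity supB.
- exact: walk_sup_similarity supC.
- exact: walk_sup_similarity supD.
- move=> x y; rewrite -EAB ?ECD // => *; rewrite ?kH //.
    by rewrite -surjective_pairing hK.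
  by rewrite -surjective_pairing.
Qed.

End WalkSimilarity.

(** * The Cartesian product *)

Definition cart (T1 T2 : finType) (r1 : rel T1) (r2 : rel T2) : rel (T1 * T2)%type :=
  fun x y => ((x.1 == y.1) && r2 x.2 y.2) || (r1 x.1 y.1 && (x.2 == y.2)).

Definition simple_connected (T : finType) (r : rel T) : Prop :=
  [/\ symmetric r, irreflexive r, 0 < #|T| & forall x y, connect r x y].

Lemma conn_simpleP G : conn_simple G <-> simple_connected (@adj G).
Proof.
rewrite /conn_simple /simple /connected /undirected; split.
  case/andP=> /andP[/forallP us /forallP ir] /andP[n0 /forallP co]; split.
  - by move=> x y; have /forallP/(_ y)/eqP := us x.
  - by move=> x; apply/negbTE.
  - by rewrite card_ord.
  - by move=> x y; have /forallP := co x; apply.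
case=> us ir n0 co; apply/andP; split; last first.
  rewrite card_ord in n0; rewrite n0; apply/forallP=> x; apply/forallP=> y.
  exact: co.
apply/andP; split; apply/forallP => x; last by rewrite ir.
by apply/forallP => y; rewrite us.
Qed.

Lemma cart_iso (T1 T2 T1' T2' : finType) (r1 : rel T1) (r2 : rel T2)
    (r1' : rel T1') (r2' : rel T2') :
  iso r1 r1' -> iso r2 r2' -> iso (cart r1 r2) (cart r1' r2').
Proof.
move=> [h [h' hK h'K] hr] [k [k' kK k'K] kr].
exists (fun x => (h x.1, k x.2)).
  by exists (fun x => (h' x.1, k' x.2)) => -[x y] /=; rewrite ?hK ?kK ?h'K ?k'K.
by move=> x y; rewrite /cart /= hr kr !(can_eq hK, can_eq kK).
Qed.

Lemma cartC (T1 T2 : finType) (r1 : rel T1) (r2 : rel T2) :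
  iso (cart r1 r2) (cart r2 r1).
Proof.
exists (fun x => (x.2, x.1)); first by exists (fun x => (x.2, x.1)) => -[].
by move=> x y; rewrite /cart /= orbC andbC; congr (_ || _); rewrite andbC.
Qed.

Lemma cartA (T1 T2 T3 : finType) (r1 : rel T1) (r2 : rel T2) (r3 : rel T3) :
  iso (cart r1 (cart r2 r3)) (cart (cart r1 r2) r3).
Proof.
exists (fun x => ((x.1, x.2.1), x.2.2)).
  by exists (fun x => (x.1.1, (x.1.2, x.2))) => [[? []]|[[]]].
move=> [x1 [x2 x3]] [y1 [y2 y3]]; rewrite /cart /= !xpair_eqE.
move: (x1 == y1) (x2 == y2) (x3 == y3) (r1 x1 y1) (r2 x2 y2) (r3 x3 y3).
by do 6!case.
Qed.

Lemma cart1 (T : finType) (r : rel T) : iso (cart (@adj K1) r) r.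
Proof.
exists snd; first by exists (fun x => (ord0, x)) => [[u x]|//]; rewrite [u]ord1.
move=> [u x] [v y]; rewrite /cart /= [u]ord1 [v]ord1 eqxx /=.
by rewrite /adj /= ffunE orbF.
Qed.

Lemma simple_connected_iso (T1 T2 : finType) (r1 : rel T1) (r2 : rel T2) :
  iso r1 r2 -> simple_connected r1 -> simple_connected r2.
Proof.
move=> i [sy ir n0 co]; have c12 := iso_card i; have [h [k hK kK] hr] := i.
split; last 1 first.
- move=> x y; rewrite -(kK x) -(kK y); apply: connect_map (co _ _) => u v uv.
  by apply: connect1; rewrite hr.
- by move=> x y; rewrite -(kK x) -(kK y) !hr sy.
- by move=> x; rewrite -(kK x) hr ir.
- by rewrite -c12.
Qed.

Lemma simple_connected_cart (T1 T2 : finType) (r1 : rel T1) (r2 : rel T2) :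
  simple_connected r1 -> simple_connected r2 -> simple_connected (cart r1 r2).
Proof.
move=> [sy1 ir1 n1 co1] [sy2 ir2 n2 co2]; split.
- by move=> x y; rewrite /cart (eq_sym x.1) (eq_sym x.2) sy1 sy2.
- by move=> x; rewrite /cart ir1 ir2 andbF.
- by rewrite card_prod muln_gt0 n1.
move=> [x1 x2] [y1 y2]; apply: (@connect_trans _ _ (y1, x2)).
  apply: (@connect_map _ _ r1 _ (fun u => (u, x2))) (co1 x1 y1) => u v uv.
  by apply: connect1; rewrite /cart /= uv eqxx orbT.
apply: (@connect_map _ _ r2 _ (fun u => (y1, u))) (co2 x2 y2) => u v uv.
by apply: connect1; rewrite /cart /= uv eqxx.
Qed.

Lemma simple_connected_K1 : simple_connected (@adj K1).
Proof.
split; first by move=> x y; rewrite [x]ord1 [y]ord1.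
- by move=> x; rewrite /adj ffunE.
- by rewrite card_ord.
- by move=> x y; rewrite [x]ord1 [y]ord1 connect0.
Qed.

Lemma simple_connected_card1 (T : finType) (r : rel T) :
  simple_connected r -> #|T| = 1 -> iso (@adj K1) r.
Proof.
move=> [_ ir _ _] c1; have [x xP] := fintype1 c1.
exists (fun=> x); first by exists (fun=> ord0) => y; rewrite ?xP // [y]ord1.
by move=> u v; rewrite ir /adj ffunE.
Qed.

Lemma simple_connected_complete n : 0 < n -> exists r : rel 'I_n, simple_connected r.
Proof.
move=> n0; exists (fun x y => x != y); split.
- by move=> x y; rewrite eq_sym.
- by move=> x; rewrite eqxx.
- by rewrite card_ord.
- by move=> x y; case: (eqVneq x y) => [->|xy]; [apply: connect0|apply: connect1].
Qed.

Section CartesianRefinement.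

Section Factor.
Variables (X P Q S T : finType) (r : rel X).
Variables (p : X -> P) (q : X -> Q) (s : X -> S) (t : X -> T).
Hypotheses (inj : forall x y, p x = p y -> q x = q y -> s x = s y -> t x = t y -> x = y)
  (surj : forall u v w z, exists x, [/\ p x = u, q x = v, s x = w & t x = z]).

Definition axis_rel (u v : P) : bool :=
  [exists x, exists y, [&& r x y, p x == u, p y == v,
                           q x == q y, s x == s y & t x == t y]].

Lemma axis_relP u v :
  reflect (exists x y, [/\ r x y, p x = u, p y = v &
                           [/\ q x = q y, s x = s y & t x = t y]])
          (axis_rel u v).
Proof.
apply: (iffP existsP) => [[x /existsP[y /and5P[? /eqP ? /eqP ? /eqP ?]]]|].
  by case/andP=> /eqP ? /eqP ?; exists x, y.
move=> [x [y [rxy <- <- [E1 E2 E3]]]]; exists x; apply/existsP; exists y.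
by rewrite rxy E1 E2 E3 !eqxx.
Qed.

Hypotheses
  (move_st : forall x y z w, r x y -> p z = p x -> q z = q x -> p w = p y -> q w = q y ->
     s x = s y -> t x = t y -> s z = s w -> t z = t w -> r z w)
  (move_qt : forall x y z w, r x y -> p z = p x -> s z = s x -> p w = p y -> s w = s y ->
     q x = q y -> t x = t y -> q z = q w -> t z = t w -> r z w).

(** An edge parallel to the [P] axis is translated first in the [s] and [t] coordinates by
    [move_st], then in [q] and [t] by [move_qt]; together these reach every position. *)
Lemma axis_rel_lift x y : q x = q y -> s x = s y -> t x = t y ->
  axis_rel (p x) (p y) = r x y.
Proof.
move=> qxy sxy txy; apply/axis_relP/idP => [|rxy]; last by exists x, y.
move=> [z [w [rzw pz pw [qzw szw tzw]]]].
have [x1 [px1 qx1 sx1 tx1]] := surj (p z) (q z) (s x) (t x).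
have [y1 [py1 qy1 sy1 ty1]] := surj (p w) (q w) (s y) (t y).
have r1 : r x1 y1 by apply: (move_st rzw); congruence.
by apply: (move_qt r1); congruence.
Qed.

End Factor.

(** [e] embeds [A] as a slice of [X] with [s] and [t] fixed, on which [p] and [q] are coordinates.
    By the last hypothesis an edge of the slice leaves one of them unchanged. *)
Lemma cart_factor (A X P Q S T : finType) (rA : rel A) (r : rel X) (e : A -> X)
    (a : X -> A) (p : X -> P) (q : X -> Q) (s : X -> S) (t : X -> T)
    (rP : rel P) (rQ : rel Q) :
  cancel e a ->
  (forall x y, a x = a y <-> p x = p y /\ q x = q y) ->
  (forall u v, exists x, p x = u /\ q x = v) ->
  (forall u v, s (e u) = s (e v) /\ t (e u) = t (e v)) ->
  (forall u v, r (e u) (e v) = rA u v) ->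
  (forall x y, q x = q y -> s x = s y -> t x = t y -> rP (p x) (p y) = r x y) ->
  (forall x y, p x = p y -> s x = s y -> t x = t y -> rQ (q x) (q y) = r x y) ->
  (forall x y, r x y -> s x = s y -> t x = t y -> p x = p y \/ q x = q y) ->
  iso rA (cart rP rQ).
Proof.
move=> ea apq surj est rE liftP liftQ dich.
have pq_e x : p (e (a x)) = p x /\ q (e (a x)) = q x.
  by apply/apq; rewrite ea.
exists (fun u => (p (e u), q (e u))).
  pose g uv := a (sval (cid (surj uv.1 uv.2))).
  have gP uv : p (e (g uv)) = uv.1 /\ q (e (g uv)) = uv.2.
    by rewrite /g; case: cid => x [] /= <- <-; apply: pq_e.
  exists g => [u|[u v]]; last by have [/= -> ->] := gP (u, v).
  by rewrite -[RHS]ea -[LHS]ea; apply/apq/gP.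
move=> u v; rewrite /cart /= -rE; have [se te] := est u v.
apply/orP/idP => [[] /andP[]|ruv].
- by move=> /eqP pe; rewrite liftQ.
- by move=> + /eqP qe; rewrite liftP.
case: (dich _ _ ruv se te) => E; [left|right].
  by rewrite E eqxx liftQ.
by rewrite E eqxx liftP // ruv.
Qed.

Lemma cart_factor_l (P Q A : finType) (rA : rel A) (rP : rel P) (rQ : rel Q) :
  iso rA (cart rP rQ) -> simple_connected rA ->
  symmetric rP -> irreflexive rP -> simple_connected rP.
Proof.
move=> i cA syP irP; have [_ _ n0 co] := simple_connected_iso i cA.
move: n0; rewrite card_prod muln_gt0 => /andP[nP /card_gt0P[v _]].
split=> // x y; have := co (x, v) (y, v).
apply: (@connect_map _ _ _ _ fst) => z w /orP[/andP[/eqP -> _]|/andP[zw _]].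
  exact: connect0.
exact: connect1.
Qed.

Import Order.TTheory GRing.Theory Num.Theory.
Local Open Scope ring_scope.

(** The value 1/2 lies strictly between 0 and 1; for a connected graph the largest walk weight is
    then [2^-d] with [d] the graph distance. *)
Definition cart_step (T : finType) (r : rel T) (x y : T) : rat :=
  if x == y then 1 else if r x y then 2^-1 else 0.

Lemma cart_step_similarity (T : finType) (r : rel T) :
  simple_connected r -> step_similarity (cart_step r).
Proof.
move=> [_ _ _ co]; rewrite /cart_step; split=> [x|x y|x y|x y].
- by rewrite eqxx.
- by do 2?case: ifP.
- by case: eqP => // _; case: ifP.
apply: (connect_map (h := id)) (co x y) => u v uv.
by apply: connect1; rewrite uv; case: ifP.
Qed.

Lemma cart_step_le (T1 T2 : finType) (r1 : rel T1) (r2 : rel T2) x y :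
  cart_step (cart r1 r2) x y <= cart_step r1 x.1 y.1 * cart_step r2 x.2 y.2.
Proof.
case: x y => [x1 x2] [y1 y2]; rewrite /cart_step /cart xpair_eqE /=.
by case: eqP; case: eqP => /=; case: (r1 _ _); case: (r2 _ _).
Qed.

Lemma cart_step_fst (T1 T2 : finType) (r1 : rel T1) (r2 : rel T2) u u' v :
  irreflexive r2 -> cart_step (cart r1 r2) (u, v) (u', v) = cart_step r1 u u'.
Proof.
by move=> ir; rewrite /cart_step /cart xpair_eqE /= eqxx ir !andbT andbF.
Qed.

Lemma cart_step_snd (T1 T2 : finType) (r1 : rel T1) (r2 : rel T2) u v v' :
  irreflexive r1 -> cart_step (cart r1 r2) (u, v) (u, v') = cart_step r2 v v'.
Proof.
by move=> ir; rewrite /cart_step /cart xpair_eqE /= eqxx ir orbF.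
Qed.

(** An edge changes one of the [A], [B] coordinates and one of the [C], [D] coordinates, hence
    exactly one of the four common coordinates. The factor graphs are therefore the four axis
    relations. *)
Theorem cart_refinement (A B C D : finType)
    (rA : rel A) (rB : rel B) (rC : rel C) (rD : rel D) :
  simple_connected rA -> simple_connected rB ->
  simple_connected rC -> simple_connected rD ->
  iso (cart rA rB) (cart rC rD) ->
  exists (P Q S T : finType) (rP : rel P) (rQ : rel Q) (rS : rel S) (rT : rel T),
    [/\ simple_connected rP, simple_connected rQ,
        simple_connected rS & simple_connected rT] /\
    [/\ iso rA (cart rP rQ), iso rB (cart rS rT), iso rC (cart rP rS) &
        iso rD (cart rQ rT)].
Proof.
move=> cA cB cC cD [h [k hK kH] hr].
have [syA irA /card_gt0P[a0 _] _] := cA; have [syB irB /card_gt0P[b0 _] _] := cB.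
have [syC irC /card_gt0P[c0 _] _] := cC; have [syD irD /card_gt0P[d0 _] _] := cD.
have step_h x y : cart_step (cart rA rB) x y = cart_step (cart rC rD) (h x) (h y).
  by rewrite /cart_step hr (can_eq hK).
have cAB := simple_connected_cart cA cB.
have [syAB irAB _ _] := cAB.
have [] := @refinement_of_steps rat A B C D h k (cart_step (cart rA rB))
  (cart_step rA) (cart_step rB) (cart_step rC) (cart_step rD) hK kH (a0, b0)
  (cart_step_similarity cA) (cart_step_similarity cB) (cart_step_similarity cC)
  (cart_step_similarity cD) (cart_step_similarity cAB).
- exact: cart_step_le.
- by move=> *; apply: cart_step_fst.
- by move=> *; apply: cart_step_snd.
- by move=> x y; rewrite step_h; apply: cart_step_le.
- by move=> *; rewrite step_h !kH; apply: cart_step_fst.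
- by move=> *; rewrite step_h !kH; apply: cart_step_snd.
move=> P [Q [S [T [p [q [s [t [[apq bst cps dqt] surj]]]]]]]].
pose r := cart rA rB.
have inj x y : p x = p y -> q x = q y -> s x = s y -> t x = t y -> x = y.
  move=> px qx sx tx; rewrite [x]surjective_pairing [y]surjective_pairing.
  by rewrite ((apq x y).2 _) ?((bst x y).2 _).
(* The four [move] facts: an edge in the direction of one factor persists under translation along
   the complementary factor. *)
have moveA x y z w : r x y -> p z = p x -> q z = q x -> p w = p y -> q w = q y ->
    s x = s y -> t x = t y -> s z = s w -> t z = t w -> r z w.
  move=> rxy pz qz pw qw sx tx sz tz.
  have /eqP bx : x.2 = y.2 by apply/bst.
  have /eqP bz : z.2 = w.2 by apply/bst.
  have az : z.1 = x.1 by apply/apq.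
  have aw : w.1 = y.1 by apply/apq.
  by move: rxy; rewrite /r /cart az aw bx bz (eqP bx) (eqP bz) !irB !andbF.
have moveB x y z w : r x y -> s z = s x -> t z = t x -> s w = s y -> t w = t y ->
    p x = p y -> q x = q y -> p z = p w -> q z = q w -> r z w.
  move=> rxy sz tz sw tw px qx pz qz.
  have /eqP ax : x.1 = y.1 by apply/apq.
  have /eqP az : z.1 = w.1 by apply/apq.
  have bz : z.2 = x.2 by apply/bst.
  have bw : w.2 = y.2 by apply/bst.
  by move: rxy; rewrite /r /cart bz bw ax az (eqP ax) (eqP az) !irA.
have moveC x y z w : r x y -> p z = p x -> s z = s x -> p w = p y -> s w = s y ->
    q x = q y -> t x = t y -> q z = q w -> t z = t w -> r z w.
  rewrite /r -!hr => rxy pz sz pw sw qx tx qz tz.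
  have /eqP dx : (h x).2 = (h y).2 by apply/dqt.
  have /eqP dz : (h z).2 = (h w).2 by apply/dqt.
  have cz : (h z).1 = (h x).1 by apply/cps.
  have cw : (h w).1 = (h y).1 by apply/cps.
  by move: rxy; rewrite /cart cz cw dx dz (eqP dx) (eqP dz) !irD !andbF.
have moveD x y z w : r x y -> q z = q x -> t z = t x -> q w = q y -> t w = t y ->
    p x = p y -> s x = s y -> p z = p w -> s z = s w -> r z w.
  rewrite /r -!hr => rxy qz tz qw tw px sx pz sz.
  have /eqP cx : (h x).1 = (h y).1 by apply/cps.
  have /eqP cz : (h z).1 = (h w).1 by apply/cps.
  have dz : (h z).2 = (h x).2 by apply/dqt.
  have dw : (h w).2 = (h y).2 by apply/dqt.
  by move: rxy; rewrite /cart dz dw cx cz (eqP cx) (eqP cz) !irC.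
(* Order of arguments after the own coordinate: the partner within [A] or [B], the partner within
   [C] or [D], then the opposite one. *)
pose rP := axis_rel r p q s t; pose rQ := axis_rel r q p t s.
pose rS := axis_rel r s t p q; pose rT := axis_rel r t s q p.
have liftP x y : q x = q y -> s x = s y -> t x = t y -> rP (p x) (p y) = r x y.
  exact: axis_rel_lift.
have liftQ x y : p x = p y -> t x = t y -> s x = s y -> rQ (q x) (q y) = r x y.
  apply: axis_rel_lift => //.
  - by move=> u v w z; have [g [? ? ? ?]] := surj v u z w; exists g.
  - by move=> x' y' z' w' *; apply: (@moveA x' y').
have liftS x y : t x = t y -> p x = p y -> q x = q y -> rS (s x) (s y) = r x y.
  apply: axis_rel_lift => //.
  - by move=> u v w z; have [g [? ? ? ?]] := surj w z u v; exists g.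
  - by move=> x' y' z' w' *; apply: (@moveC x' y').
have liftT x y : s x = s y -> q x = q y -> p x = p y -> rT (t x) (t y) = r x y.
  apply: axis_rel_lift => //.
  - by move=> u v w z; have [g [? ? ? ?]] := surj z w v u; exists g.
  - by move=> x' y' z' w' *; apply: (@moveB x' y').
  - by move=> x' y' z' w' *; apply: (@moveD x' y').
have dichCD x y : r x y -> (p x = p y /\ s x = s y) \/ (q x = q y /\ t x = t y).
  rewrite /r -hr => /orP[/andP[/eqP/cps]|/andP[_ /eqP/dqt]]; first by left.
  by right.
have dichAB x y : r x y -> (p x = p y /\ q x = q y) \/ (s x = s y /\ t x = t y).
  by move=> /orP[/andP[/eqP/apq]|/andP[_ /eqP/bst]]; [left|right].
have iA : iso rA (cart rP rQ).
  apply: (@cart_factor A _ P Q S T rA r (fun u => (u, b0)) fst p q s t) => //.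
  - by move=> u v; have [x [? ? _ _]] := surj u v (s (a0, b0)) (t (a0, b0)); exists x.
  - by move=> u v; apply/bst.
  - by move=> u v; rewrite /r /cart /= irB andbF eqxx andbT.
  - by move=> *; apply: liftQ.
  - by move=> x y /dichCD [[]|[]]; [left|right].
have iB : iso rB (cart rS rT).
  apply: (@cart_factor B _ S T P Q rB r (fun u => (a0, u)) snd s t p q) => //.
  - by move=> u v; have [x [_ _ ? ?]] := surj (p (a0, b0)) (q (a0, b0)) u v; exists x.
  - by move=> u v; apply/apq.
  - by move=> u v; rewrite /r /cart /= irA eqxx orbF.
  - by move=> *; apply: liftT.
  - by move=> x y /dichCD [[]|[]]; [left|right].
have iC : iso rC (cart rP rS).
  apply: (@cart_factor C _ P S Q T rC r (fun u => k (u, d0)) (fst \o h) p s q t) => //.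
  - by move=> u; rewrite /= kH.
  - by move=> u v; have [x [? _ ? _]] := surj u (q (a0, b0)) v (t (a0, b0)); exists x.
  - by move=> u v; apply/dqt; rewrite !kH.
  - by move=> u v; rewrite /r -hr !kH /cart /= irD andbF eqxx andbT.
  - by move=> *; apply: liftP.
  - by move=> *; apply: liftS.
  - by move=> x y /dichAB [[]|[]]; [left|right].
have iD : iso rD (cart rQ rT).
  apply: (@cart_factor D _ Q T P S rD r (fun u => k (c0, u)) (snd \o h) q t p s) => //.
  - by move=> u; rewrite /= kH.
  - by move=> u v; have [x [_ ? _ ?]] := surj (p (a0, b0)) u (s (a0, b0)) v; exists x.
  - by move=> u v; apply/cps; rewrite !kH.
  - by move=> u v; rewrite /r -hr !kH /cart /= irC eqxx orbF.
  - by move=> *; apply: liftQ.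
  - by move=> *; apply: liftT.
  - by move=> x y /dichAB [[]|[]]; [left|right].
have sym_axis (U V W Z : finType) (u : _ -> U) (v : _ -> V) (w : _ -> W) (z : _ -> Z) :
    symmetric (axis_rel r u v w z).
  move=> i j; apply/axis_relP/axis_relP => -[x [y [rxy ? ? [? ? ?]]]];
  by exists y, x; rewrite /r syAB.
have irr_axis (U V W Z : finType) (u : _ -> U) (v : _ -> V) (w : _ -> W) (z : _ -> Z) :
    (forall x y, u x = u y -> v x = v y -> w x = w y -> z x = z y -> x = y) ->
    irreflexive (axis_rel r u v w z).
  move=> uvwz i; apply/negbTE/axis_relP => -[x [y [rxy ux uy [vx wx zx]]]].
  by move: rxy; rewrite /r (uvwz x y) ?irAB // ux uy.
exists P, Q, S, T, rP, rQ, rS, rT; split=> //; split.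
- by apply: cart_factor_l iA cA (sym_axis _ _ _ _ _ _ _ _) (irr_axis _ _ _ _ _ _ _ _ _).
- apply: cart_factor_l iD cD (sym_axis _ _ _ _ _ _ _ _) (irr_axis _ _ _ _ _ _ _ _ _).
  by move=> *; apply: inj.
- apply: cart_factor_l iB cB (sym_axis _ _ _ _ _ _ _ _) (irr_axis _ _ _ _ _ _ _ _ _).
  by move=> *; apply: inj.
- apply: cart_factor_l (iso_trans iB (cartC _ _)) cB (sym_axis _ _ _ _ _ _ _ _)
    (irr_axis _ _ _ _ _ _ _ _ _).
  by move=> *; apply: inj.
Qed.

End CartesianRefinement.

(** * The direct product *)

Definition dirp (T1 T2 : finType) (r1 : rel T1) (r2 : rel T2) : rel (T1 * T2)%type :=
  fun x y => r1 x.1 y.1 && r2 x.2 y.2.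

Definition nonbip_connected (T : finType) (r : rel T) : Prop :=
  [/\ symmetric r, 0 < #|T|, forall x y, connect r x y &
      ~ exists c : T -> bool, forall x y, r x y -> c x != c y].

Definition sqrel (T : finType) (r : rel T) : rel T :=
  fun x y => [exists z, r x z && r z y].

Lemma sqrelP (T : finType) (r : rel T) x y :
  reflect (exists2 z, r x z & r z y) (sqrel r x y).
Proof.
apply: (iffP existsP) => [[z /andP[xz zy]]|[z xz zy]]; first by exists z.
by exists z; rewrite xz.
Qed.

(** Any two vertices are joined by a walk of even length. This walk form of nonbipartite
    connectedness passes more easily to products, factors and twin quotients. *)
Definition evenly_connected (T : finType) (r : rel T) : Prop :=
  [/\ symmetric r, 0 < #|T|, forall x, exists y, r x y &
      forall x y, connect (sqrel r) x y].

Lemma conn_nonbipP G : conn_nonbip G <-> nonbip_connected (@adj G).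
Proof.
rewrite /conn_nonbip /connected /undirected; split.
  case/andP=> /andP[/forallP us /andP[n0 /forallP co]] nb; split.
  - by move=> x y; have /forallP/(_ y)/eqP := us x.
  - by rewrite card_ord.
  - by move=> x y; have /forallP := co x; apply.
  case=> c cP; case/negP: nb; apply/existsP; exists (finfun c).
  by apply/forallP=> x; apply/forallP=> y; apply/implyP; rewrite !ffunE; apply: cP.
case=> us n0 co nb; rewrite card_ord in n0; rewrite n0 /= -andbA.
apply/and3P; split.
- by apply/forallP => x; apply/forallP => y; rewrite us.
- by apply/forallP => x; apply/forallP => y; apply: co.
apply/negP => /existsP[c /forallP cP]; apply: nb; exists (fun x => c x) => x y.
by have /forallP/(_ y)/implyP := cP x.
Qed.

(** Adding one edge at each end of an even walk keeps its length even, and the steps are regrouped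
    in pairs. *)
Lemma connect_sqrel_shift (T : finType) (r : rel T) : symmetric r ->
  forall x y x' y', connect (sqrel r) x y -> r x x' -> r y y' ->
  connect (sqrel r) x' y'.
Proof.
move=> sy x y x' y' /connectP[p pp ->] {y}.
elim: p x x' pp => [|z p IH] x x' /=.
  by move=> _ xx' xy'; apply/connect1/sqrelP; exists x; rewrite // sy.
move=> /andP[/sqrelP[w xw wz] pz] xx' yy'.
apply: (@connect_trans _ _ w); last by apply: IH yy' => //; rewrite sy.
by apply/connect1/sqrelP; exists x; rewrite // sy.
Qed.

(** A proper 2-colouring is constant along even walks, so even connectedness excludes it.
    Conversely, colouring by even reachability from [x] fails at some edge, and this produces an
    even walk from [x] to its neighbour [x1]. *)
Lemma evenly_connectedP (T : finType) (r : rel T) :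
  nonbip_connected r <-> evenly_connected r.
Proof.
split=> [[sy n0 co nb]|[sy n0 nbr co]]; last first.
  have cst (c : T -> bool) : (forall x y, r x y -> c x != c y) ->
      forall x y, connect (sqrel r) x y -> c x = c y.
    move=> cP x y /connectP[p pp ->]; elim: p x pp => //= z p IH x.
    case/andP=> /sqrelP[w /cP xw /cP wz] /IH <-.
    by move: xw wz; case: (c x) (c w) (c z) => [] [] [].
  split=> //; first move=> x y.
    apply: (connect_map (h := id)) (co x y) => u v /sqrelP[w uw wv].
    by apply: (@connect_trans _ _ w); apply: connect1.
  case=> c cP; have /card_gt0P[x _] := n0; have [y xy] := nbr x.
  by have := cP x y xy; rewrite (cst c cP x y (co x y)) eqxx.
(* A vertex with no neighbour would be the whole graph by connectedness, and loopless, hence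
   bipartite. *)
have nbr x : exists y, r x y.
  apply: contrapT => no_nbr; have iso_x y : r x y = false.
    by apply/negP => xy; apply: no_nbr; exists y.
  have one y : y = x.
    have /connectP[[|z p] /=] := co x y; first by [].
    by rewrite iso_x.
  apply: nb; exists (fun=> true) => u v; rewrite (one u) (one v).
  by rewrite iso_x.
split=> // x y; have [x1 xx1] := nbr x.
have csym : connect_sym (sqrel r).
  apply: sym_connect_sym => u v.
  by apply/sqrelP/sqrelP => -[w ? ?]; exists w; rewrite // sy.
have shift := connect_sqrel_shift sy.
have EO u : connect (sqrel r) x u || connect (sqrel r) x1 u.
  have /connectP[p pp ->] := co x u.
  have gen w : path r w p -> connect (sqrel r) x w || connect (sqrel r) x1 w ->
      connect (sqrel r) x (last w p) || connect (sqrel r) x1 (last w p).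
    elim: p w {pp} => //= z p IH w /andP[wz pz] H; apply: IH pz _.
    case/orP: H => H; first by rewrite (shift _ _ _ _ H xx1 wz) orbT.
    by rewrite (shift _ _ _ _ H _ wz) // sy.
  by apply: gen pp _; rewrite connect0.
have [u [v [uv Euv]]] : exists u v, r u v /\ connect (sqrel r) x u = connect (sqrel r) x v.
  apply: contrapT => H; apply: nb; exists (connect (sqrel r) x) => u v uv.
  by apply/negP=> /eqP E; apply: H; exists u, v.
have Ex : connect (sqrel r) x x1.
  have H w z : r w z -> ~~ connect (sqrel r) x w -> connect (sqrel r) x z.
    move=> wz nw; have := EO w; rewrite (negbTE nw) /= => x1w.
    by apply: shift x1w _ wz; rewrite sy.
  have xv : connect (sqrel r) x v.
    by apply/negPn/negP => nv; move: (nv); rewrite -Euv => /(H _ _ uv); apply/negP.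
  have xu : connect (sqrel r) x u by rewrite Euv.
  by apply: connect_trans xv _; rewrite csym; apply: shift xu xx1 uv.
by have /orP[//|] := EO y; apply: connect_trans.
Qed.

Lemma evenly_connected_iso (T1 T2 : finType) (r1 : rel T1) (r2 : rel T2) :
  iso r1 r2 -> evenly_connected r1 -> evenly_connected r2.
Proof.
move=> i [sy n0 nbr co]; have c12 := iso_card i; have [h [k hK kK] hr] := i; split.
- by move=> x y; rewrite -(kK x) -(kK y) !hr sy.
- by rewrite -c12.
- by move=> x; have [y xy] := nbr (k x); exists (h y); rewrite -(kK x) hr.
move=> x y; rewrite -(kK x) -(kK y); apply: connect_map (co _ _) => u v.
by case/sqrelP=> w uw wv; apply/connect1/sqrelP; exists (h w); rewrite hr.
Qed.

Lemma sqrel_refl (T : finType) (r : rel T) :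
  evenly_connected r -> reflexive (sqrel r).
Proof.
by case=> sy _ nbr _ x; have [y xy] := nbr x; apply/sqrelP; exists y; rewrite // sy.
Qed.

Lemma sqrel_dirp (T1 T2 : finType) (r1 : rel T1) (r2 : rel T2) x y :
  sqrel (dirp r1 r2) x y = sqrel r1 x.1 y.1 && sqrel r2 x.2 y.2.
Proof.
apply/sqrelP/andP => [[z /andP[? ?] /andP[? ?]]|].
  by split; apply/sqrelP; [exists z.1|exists z.2].
case=> /sqrelP[u ? ?] /sqrelP[v ? ?]; exists (u, v); exact/andP.
Qed.

Lemma evenly_connected_dirp (T1 T2 : finType) (r1 : rel T1) (r2 : rel T2) :
  evenly_connected r1 -> evenly_connected r2 -> evenly_connected (dirp r1 r2).
Proof.
move=> ec1 ec2; have [sy1 n1 nbr1 co1] := ec1; have [sy2 n2 nbr2 co2] := ec2.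
split.
- by move=> x y; rewrite /dirp sy1 sy2.
- by rewrite card_prod muln_gt0 n1.
- move=> x; have [u xu] := nbr1 x.1; have [v xv] := nbr2 x.2.
  by exists (u, v); rewrite /dirp xu.
move=> [x1 x2] [y1 y2]; apply: (@connect_trans _ _ (y1, x2)).
  apply: (@connect_map _ _ _ _ (fun u => (u, x2))) (co1 x1 y1) => u v uv.
  by apply: connect1; rewrite sqrel_dirp uv sqrel_refl.
apply: (@connect_map _ _ _ _ (fun u => (y1, u))) (co2 x2 y2) => u v uv.
by apply: connect1; rewrite sqrel_dirp uv sqrel_refl.
Qed.

Lemma evenly_connected_factor (T1 T2 : finType) (r1 : rel T1) (r2 : rel T2) :
  symmetric r1 -> evenly_connected (dirp r1 r2) -> evenly_connected r1.
Proof.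
move=> sy [_ + nbr co]; rewrite card_prod muln_gt0 => /andP[n1 /card_gt0P[v _]].
split=> // [x|x y]; first by have [y /andP[xy _]] := nbr (x, v); exists y.1.
apply: (@connect_map _ _ _ _ fst) (co (x, v) (y, v)) => z w.
by rewrite sqrel_dirp => /andP[zw _]; apply: connect1.
Qed.

Lemma dirp_iso (T1 T2 T1' T2' : finType) (r1 : rel T1) (r2 : rel T2)
    (r1' : rel T1') (r2' : rel T2') :
  iso r1 r1' -> iso r2 r2' -> iso (dirp r1 r2) (dirp r1' r2').
Proof.
move=> [h [h' hK h'K] hr] [k [k' kK k'K] kr].
exists (fun x => (h x.1, k x.2)).
  by exists (fun x => (h' x.1, k' x.2)) => -[x y] /=; rewrite ?hK ?kK ?h'K ?k'K.
by move=> x y; rewrite /dirp /= hr kr.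
Qed.

Lemma dirpC (T1 T2 : finType) (r1 : rel T1) (r2 : rel T2) :
  iso (dirp r1 r2) (dirp r2 r1).
Proof.
exists (fun x => (x.2, x.1)); first by exists (fun x => (x.2, x.1)) => -[].
by move=> x y; rewrite /dirp andbC.
Qed.

Lemma dirpA (T1 T2 T3 : finType) (r1 : rel T1) (r2 : rel T2) (r3 : rel T3) :
  iso (dirp r1 (dirp r2 r3)) (dirp (dirp r1 r2) r3).
Proof.
exists (fun x => ((x.1, x.2.1), x.2.2)).
  by exists (fun x => (x.1.1, (x.1.2, x.2))) => [[? []]|[[]]].
by move=> x y; rewrite /dirp andbA.
Qed.

Lemma dirp1 (T : finType) (r : rel T) : iso (dirp (@adj K1loop) r) r.
Proof.
exists snd; first by exists (fun x => (ord0, x)) => [[u x]|//]; rewrite [u]ord1.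
by move=> [u x] [v y]; rewrite /dirp /adj /= ffunE.
Qed.

(** * Splitting the sizes of twin classes *)

Section WeightRefinement.
Variables (P Q S T : finType) (p0 : P) (q0 : Q) (s0 : S) (t0 : T).
Variables (wA : P -> Q -> nat) (wB : S -> T -> nat) (wC : P -> S -> nat)
  (wD : Q -> T -> nat).
Hypotheses (A0 : forall p q, 0 < wA p q) (B0 : forall s t, 0 < wB s t)
  (C0 : forall p s, 0 < wC p s).
Hypothesis E : forall p q s t, wA p q * wB s t = wC p s * wD q t.

(** [E] forces the ratio of the weights at [p] and [p'] to be the same in [wA] and in [wC], whatever
    [q] and [s]. *)
Let AC p p' q s : wA p q * wC p' s = wA p' q * wC p s.
Proof.
apply/eqP; rewrite -(eqn_pmul2r (B0 s t0)) mulnAC E.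
rewrite [X in _ == X]mulnAC E; apply/eqP; nia.
Qed.

Let AA p p' q q' : wA p q * wA p' q' = wA p' q * wA p q'.
Proof.
apply/eqP; rewrite -(eqn_pmul2r (C0 p s0)); apply/eqP.
have := AC p p' q s0; have := AC p p' q' s0; nia.
Qed.

Let CC p p' s s' : wC p s * wC p' s' = wC p' s * wC p s'.
Proof.
apply/eqP; rewrite -(eqn_pmul2r (A0 p q0)); apply/eqP.
have := AC p p' q0 s; have := AC p p' q0 s'; nia.
Qed.

(** The greatest integer dividing every entry at [p] of both tables; 0 is the neutral element of
    [gcdn]. *)
Let wP p := gcdn (\big[gcdn/0]_q wA p q) (\big[gcdn/0]_s wC p s).

Let big_gcd_mulr (I : finType) (F : I -> nat) n :
  (\big[gcdn/0]_i F i) * n = \big[gcdn/0]_i (F i * n).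
Proof. by apply: (big_morph (fun m => m * n)) => // x y; rewrite muln_gcdl. Qed.

Let big_gcd_dvd (I : finType) (F : I -> nat) i : \big[gcdn/0]_i F i %| F i.
Proof. by rewrite (bigD1 i) //= dvdn_gcdl. Qed.

Let dvd_big_gcd (I : finType) (F : I -> nat) d :
  (forall i, d %| F i) -> d %| \big[gcdn/0]_i F i.
Proof.
move=> H; apply: (big_ind (fun m => d %| m)) => // x y dx dy.
by rewrite dvdn_gcd dx.
Qed.

Let wP_dvdA p q : wP p %| wA p q.
Proof. exact: dvdn_trans (dvdn_gcdl _ _) (big_gcd_dvd _ _). Qed.
Let wP_dvdC p s : wP p %| wC p s.
Proof. exact: dvdn_trans (dvdn_gcdr _ _) (big_gcd_dvd _ _). Qed.

Let wP_gt0 p : 0 < wP p.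
Proof. by have := dvdn_gt0 (A0 p q0) (wP_dvdA p q0). Qed.

(** Multiplication distributes over gcds; after that the entries agree one by one through [AA] and
    [AC], so [wP] inherits the common ratio. *)
Let wPA p q : wP p * wA p0 q = wP p0 * wA p q.
Proof.
rewrite /wP !muln_gcdl !big_gcd_mulr; congr gcdn; apply: eq_bigr => i _.
  by rewrite AA; lia.
by have := AC p0 p q i; lia.
Qed.

Let wPC p s : wP p * wC p0 s = wP p0 * wC p s.
Proof.
rewrite /wP !muln_gcdl !big_gcd_mulr; congr gcdn; apply: eq_bigr => i _.
  by have := AC p p0 i s; lia.
by rewrite CC; lia.
Qed.

Let wQ q := wA p0 q %/ wP p0.
Let wS s := wC p0 s %/ wP p0.
Let wT t := wB s0 t %/ wS s0.

Let EA p q : wA p q = wP p * wQ q.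
Proof.
apply/eqP; rewrite -(eqn_pmul2l (wP_gt0 p0)) -wPA mulnCA; apply/eqP.
by congr (_ * _); rewrite mulnC divnK.
Qed.

Let EC p s : wC p s = wP p * wS s.
Proof.
apply/eqP; rewrite -(eqn_pmul2l (wP_gt0 p0)) -wPC mulnCA; apply/eqP.
by congr (_ * _); rewrite mulnC divnK.
Qed.

Let Q0 q : 0 < wQ q.
Proof. by have := A0 p0 q; rewrite EA muln_gt0 => /andP[]. Qed.
Let S0 s : 0 < wS s.
Proof. by have := C0 p0 s; rewrite EC muln_gt0 => /andP[]. Qed.

Let QB q s t : wQ q * wB s t = wS s * wD q t.
Proof.
by apply/eqP; rewrite -(eqn_pmul2l (wP_gt0 p0)) !mulnA -EA -EC E.
Qed.

Let SB s s' t : wS s * wB s' t = wS s' * wB s t.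
Proof.
apply/eqP; rewrite -(eqn_pmul2l (Q0 q0)) !(mulnCA (wQ q0)) !QB; apply/eqP; lia.
Qed.

Let gcdQS : gcdn (\big[gcdn/0]_q wQ q) (\big[gcdn/0]_s wS s) = 1.
Proof.
apply/eqP; rewrite -(eqn_pmul2r (wP_gt0 p0)) mul1n muln_gcdl !big_gcd_mulr.
by apply/eqP; congr gcdn; apply: eq_bigr => i _; rewrite ?EA ?EC mulnC.
Qed.

(* [wB s0 t / wS s0] becomes integral after multiplication by any [wQ q] or
   any [wS s], and these have no common factor. *)
Let wS_dvdB t : wS s0 %| wB s0 t.
Proof.
rewrite -[wB s0 t]mul1n -gcdQS muln_gcdl !big_gcd_mulr dvdn_gcd.
by rewrite !dvd_big_gcd // => i; [rewrite SB|rewrite QB]; rewrite dvdn_mulr.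
Qed.

Let EB s t : wB s t = wS s * wT t.
Proof.
apply/eqP; rewrite -(eqn_pmul2l (S0 s0)) SB mulnCA; apply/eqP.
by congr (_ * _); rewrite mulnC divnK.
Qed.

Let ED q t : wD q t = wQ q * wT t.
Proof.
apply/eqP; rewrite -(eqn_pmul2l (S0 s0)) -QB EB; apply/eqP; lia.
Qed.

Lemma weight_refinement : exists wP wQ wS wT,
  [/\ forall p q, wA p q = wP p * wQ q, forall s t, wB s t = wS s * wT t,
      forall p s, wC p s = wP p * wS s & forall q t, wD q t = wQ q * wT t].
Proof. by exists wP, wQ, wS, wT. Qed.

End WeightRefinement.

(** Both relations are pulled back from [e], so it suffices to match fibres of equal size, here by
    position in their enumerations; [y0] is the default of [nth]. *)
Lemma iso_of_fibers (T1 T2 U : finType) (f1 : T1 -> U) (f2 : T2 -> U)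
    (r1 : rel T1) (r2 : rel T2) (e : rel U) (y0 : T2) :
  (forall x y, r1 x y = e (f1 x) (f1 y)) ->
  (forall x y, r2 x y = e (f2 x) (f2 y)) ->
  (forall u, #|[pred x | f1 x == u]| = #|[pred x | f2 x == u]|) ->
  iso r1 r2.
Proof.
move=> r1E r2E fib.
pose h x := nth y0 (enum [pred y | f2 y == f1 x])
  (index x (enum [pred y | f1 y == f1 x])).
have idx x : index x (enum [pred y | f1 y == f1 x]) <
             size (enum [pred y | f2 y == f1 x]).
  by rewrite -cardE -fib cardE index_mem mem_enum inE.
have fh x : f2 (h x) = f1 x.
  by have := mem_nth y0 (idx x); rewrite mem_enum inE => /eqP.
have card_fib (T : finType) (f : T -> U) : #|T| = \sum_u #|[pred x | f x == u]|.
  rewrite -sum1_card (partition_big f predT) //=; apply: eq_bigr => u _.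
  by rewrite -sum1_card; apply: eq_bigl => x; rewrite inE.
exists h; last by move=> x y; rewrite r2E !fh r1E.
apply: inj_card_bij; last first.
  by rewrite (card_fib _ f1) (card_fib _ f2) (eq_bigr _ (fun u _ => fib u)).
move=> x y E; have fxy : f1 x = f1 y by rewrite -!fh E.
move: E; rewrite /h -fxy => /eqP; rewrite nth_uniq ?enum_uniq //; last first.
  by have := idx y; rewrite fxy.
move=> /eqP E; have xin : x \in enum [pred z | f1 z == f1 x] by rewrite mem_enum inE.
have yin : y \in enum [pred z | f1 z == f1 x] by rewrite mem_enum inE fxy.
by rewrite -(nth_index x xin) E nth_index.
Qed.

(** * Step weights from common neighbours *)

Section ThinSteps.
Import Order.TTheory GRing.Theory Num.Theory.
Local Open Scope ring_scope.

Definition common (T : finType) (r : rel T) (x y : T) : nat :=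
  #|[pred z | r x z && r y z]|.

Definition thin (T : finType) (r : rel T) : Prop :=
  forall x y, r x =1 r y -> x = y.

(* The squared cosine of the angle between the neighbourhood indicator vectors
   of [x] and [y]. *)
Definition thin_step (T : finType) (r : rel T) (x y : T) : rat :=
  (common r x y)%:R ^+ 2 / ((common r x x)%:R * (common r y y)%:R).

Lemma commonC (T : finType) (r : rel T) x y : common r x y = common r y x.
Proof. by apply: eq_card => z; rewrite !inE andbC. Qed.

Lemma common_le (T : finType) (r : rel T) x y : (common r x y <= common r x x)%N.
Proof.
by apply: subset_leq_card; apply/fintype.subsetP => z; rewrite !inE => /andP[->].
Qed.

Lemma common_eq (T : finType) (r : rel T) x y :
  common r x y = common r x x -> forall z, r x z -> r y z.
Proof.
move=> E z xz; have sub : [pred z | r x z && r y z] \subset [pred z | r x z && r x z].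
  by apply/fintype.subsetP => w; rewrite !inE => /andP[->].
have := subset_cardP E sub z; rewrite !inE xz /=.
by [].
Qed.

Lemma common_iso (T1 T2 : finType) (r1 : rel T1) (r2 : rel T2) (h : T1 -> T2) :
  bijective h -> (forall x y, r2 (h x) (h y) = r1 x y) ->
  forall x y, common r2 (h x) (h y) = common r1 x y.
Proof.
move=> bh hr x y; rewrite /common -(fintype.card_image (bij_inj bh) [pred z | r1 x z && r1 y z]); apply: eq_card => w.
have [g gK hK] := bh; rewrite -(hK w) fintype.mem_image ?inE ?hr //.
exact: bij_inj.
Qed.

Lemma common_dirp (T1 T2 : finType) (r1 : rel T1) (r2 : rel T2) x y :
  common (dirp r1 r2) x y = (common r1 x.1 y.1 * common r2 x.2 y.2)%N.
Proof.
rewrite /common -cardX; apply: eq_card => z; rewrite !inE /dirp.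
by rewrite andbACA.
Qed.

Lemma thin_step_iso (T1 T2 : finType) (r1 : rel T1) (r2 : rel T2) (h : T1 -> T2) :
  bijective h -> (forall x y, r2 (h x) (h y) = r1 x y) ->
  forall x y, thin_step r2 (h x) (h y) = thin_step r1 x y.
Proof. by move=> bh hr x y; rewrite /thin_step !(common_iso bh hr). Qed.

Lemma thin_step_dirp (T1 T2 : finType) (r1 : rel T1) (r2 : rel T2) x y :
  thin_step (dirp r1 r2) x y = thin_step r1 x.1 y.1 * thin_step r2 x.2 y.2.
Proof.
by rewrite /thin_step !common_dirp !natrM exprMn [in X in _ / X]mulrACA invfM mulrACA.
Qed.

Variables (T : finType) (r : rel T).
Hypothesis ec : evenly_connected r.

Lemma common_gt0 x : (0 < common r x x)%N.
Proof.
case: ec => _ _ nbr _; have [y xy] := nbr x; apply/card_gt0P; exists y.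
by rewrite inE xy.
Qed.

Lemma thin_step1 x : thin_step r x x = 1.
Proof. by rewrite /thin_step -expr2 divff // expf_neq0 // pnatr_eq0 -lt0n common_gt0. Qed.

(** [common] is at most either degree, so the weight is at most 1; equality makes both
    neighbourhoods equal to their intersection, and thinness identifies the vertices. A common
    neighbour makes the weight positive, so connectedness comes from [sqrel]. *)
Lemma thin_step_similarity : thin r -> step_similarity (thin_step r).
Proof.
have c0 x : 0 < (common r x x)%:R :> rat by rewrite ltr0n common_gt0.
have cxy0 x y : 0 < (common r x x)%:R * (common r y y)%:R :> rat by rewrite mulr_gt0.
case: ec => sy _ _ co th; split.
- exact: thin_step1.
- move=> x y; rewrite /thin_step divr_ge0 ?exprn_ge0 ?ler0n ?(ltW (cxy0 _ _)) //=.
  rewrite ler_pdivrMr // mul1r expr2 ler_pM ?ler0n // ler_nat ?common_le //.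
  by rewrite commonC common_le.
- move=> x y E; apply: th => z.
  have E' : (common r x y * common r x y = common r x x * common r y y)%N.
    apply/eqP; rewrite -(eqr_nat rat) !natrM -expr2.
    have := cxy0 x y => /lt0r_neq0 n0; apply/eqP.
    by have := congr1 (fun v => v * ((common r x x)%:R * (common r y y)%:R)) E;
      rewrite /thin_step divfK // mul1r.
  have lx := common_le r x y; have ly := common_le r y x; rewrite commonC in ly.
  have x0 := common_gt0 x; have y0 := common_gt0 y.
  have Ex : common r x y = common r x x by nia.
  have Ey : common r y x = common r y y by rewrite commonC; nia.
  by apply/idP/idP; apply: common_eq.
move=> x y; apply: (connect_map (h := id)) (co x y) => u v /sqrelP[w uw wv].
apply: connect1; rewrite /thin_step divr_gt0 // exprn_gt0 // ltr0n.
by apply/card_gt0P; exists w; rewrite inE uw sy.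
Qed.

End ThinSteps.

(** A product of two nonempty neighbourhoods determines both of them. *)
Lemma dirp_twin (T1 T2 : finType) (r1 : rel T1) (r2 : rel T2) :
  evenly_connected r1 -> evenly_connected r2 ->
  forall x y, dirp r1 r2 x =1 dirp r1 r2 y <-> r1 x.1 =1 r1 y.1 /\ r2 x.2 =1 r2 y.2.
Proof.
move=> [_ _ nbr1 _] [_ _ nbr2 _] x y.
split=> [E|[E1 E2] z]; last by rewrite /dirp E1 E2.
have [u xu] := nbr1 x.1; have [u' yu'] := nbr1 y.1.
have [v xv] := nbr2 x.2; have [v' yv'] := nbr2 y.2.
split=> z; apply/idP/idP => H.
- by have := E (z, v); rewrite /dirp /= H xv => /esym/andP[].
- by have := E (z, v'); rewrite /dirp /= H yv' andbT => /andP[].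
- by have := E (u, z); rewrite /dirp /= H xu => /esym/andP[].
- by have := E (u', z); rewrite /dirp /= H yu' => /andP[].
Qed.

(** * Refinement for graphs without twins *)

Section DirectThinRefinement.
Import Order.TTheory GRing.Theory Num.Theory.
Variables (A B C D : finType) (rA : rel A) (rB : rel B) (rC : rel C) (rD : rel D).
Variables (h : A * B -> C * D) (k : C * D -> A * B).
Hypotheses (ecA : evenly_connected rA) (ecB : evenly_connected rB)
  (ecC : evenly_connected rC) (ecD : evenly_connected rD).
Hypotheses (thA : thin rA) (thB : thin rB) (thC : thin rC) (thD : thin rD).
Hypotheses (hK : cancel h k) (kH : cancel k h)
  (hr : forall x y, dirp rC rD (h x) (h y) = dirp rA rB x y).

Lemma thin_dirp : thin (dirp rA rB).
Proof.
move=> x y /(dirp_twin ecA ecB)[/thA E1 /thB E2].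
by rewrite [x]surjective_pairing E1 E2 -surjective_pairing.
Qed.

(** The factor relations are the projections of the edge relation. They recover it because the
    coordinates of several edges may be mixed freely through both decompositions. *)
Theorem direct_thin_refinement :
  exists (P Q S T : finType) (p : A * B -> P) (q : A * B -> Q) (s : A * B -> S)
    (t : A * B -> T) (rP : rel P) (rQ : rel Q) (rS : rel S) (rT : rel T),
  [/\ [/\ forall x y, x.1 = y.1 <-> p x = p y /\ q x = q y,
      forall x y, x.2 = y.2 <-> s x = s y /\ t x = t y,
      forall x y, (h x).1 = (h y).1 <-> p x = p y /\ s x = s y &
      forall x y, (h x).2 = (h y).2 <-> q x = q y /\ t x = t y],
  forall u v w r, exists x, [/\ p x = u, q x = v, s x = w & t x = r],
  [/\ symmetric rP, symmetric rQ, symmetric rS & symmetric rT] &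
  [/\ forall x y, rA x.1 y.1 = rP (p x) (p y) && rQ (q x) (q y),
      forall x y, rB x.2 y.2 = rS (s x) (s y) && rT (t x) (t y),
      forall x y, rC (h x).1 (h y).1 = rP (p x) (p y) && rS (s x) (s y) &
      forall x y, rD (h x).2 (h y).2 = rQ (q x) (q y) && rT (t x) (t y)]].
Proof.
have [syA n0A nbrA _] := ecA; have [syB n0B nbrB _] := ecB.
have [syC _ nbrC _] := ecC; have [syD _ nbrD _] := ecD.
have /card_gt0P[a0 _] := n0A; have /card_gt0P[b0 _] := n0B.
have ecAB := evenly_connected_dirp ecA ecB.
have bh : bijective h by exists k.
have step_h x y : thin_step (dirp rA rB) x y = thin_step (dirp rC rD) (h x) (h y).
  by rewrite (thin_step_iso bh hr).
have [] := @refinement_of_steps rat A B C D h k (thin_step (dirp rA rB))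
  (thin_step rA) (thin_step rB) (thin_step rC) (thin_step rD) hK kH (a0, b0)
  (thin_step_similarity ecA thA) (thin_step_similarity ecB thB)
  (thin_step_similarity ecC thC) (thin_step_similarity ecD thD)
  (thin_step_similarity ecAB thin_dirp).
- by move=> x y; rewrite thin_step_dirp.
- by move=> *; rewrite thin_step_dirp /= (thin_step1 ecB) mulr1.
- by move=> *; rewrite thin_step_dirp /= (thin_step1 ecA) mul1r.
- by move=> x y; rewrite step_h thin_step_dirp.
- by move=> *; rewrite step_h !kH thin_step_dirp /= (thin_step1 ecD) mulr1.
- by move=> *; rewrite step_h !kH thin_step_dirp /= (thin_step1 ecC) mul1r.
move=> P [Q [S [T [p [q [s [t [[apq bst cps dqt] surj]]]]]]]].
pose e := dirp rA rB.
have e_sym : symmetric e by move=> x y; rewrite /e /dirp syA syB.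
pose proj (U : finType) (u : A * B -> U) : rel U :=
  fun i j => [exists x, exists y, [&& e x y, u x == i & u y == j]].
have projP (U : finType) (u : A * B -> U) i j :
    reflect (exists x y, [/\ e x y, u x = i & u y = j]) (proj U u i j).
  apply: (iffP existsP) => [[x /existsP[y /and3P[? /eqP ? /eqP ?]]]|].
    by exists x, y.
  by move=> [x [y [exy <- <-]]]; exists x; apply/existsP; exists y; rewrite exy !eqxx.
have proj_sym (U : finType) (u : A * B -> U) : symmetric (proj U u).
  by move=> i j; apply/projP/projP => -[x [y [? ? ?]]]; exists y, x; rewrite e_sym.
have inj x y : p x = p y -> q x = q y -> s x = s y -> t x = t y -> x = y.
  move=> px qx sx tx; rewrite [x]surjective_pairing [y]surjective_pairing.
  by rewrite ((apq x y).2 _) ?((bst x y).2 _).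
pose f (x y : A * B) := (x.1, y.2); pose g x y := k ((h x).1, (h y).2).
have ef x y z w : e x y -> e z w -> e (f x z) (f y w).
  by move=> /andP[xy _] /andP[_ zw]; apply/andP.
have eg x y z w : e x y -> e z w -> e (g x z) (g y w).
  rewrite /e -!hr !kH => /andP[xy _] /andP[_ zw]; exact/andP.
have pf x y : p (f x y) = p x /\ q (f x y) = q x by apply/apq.
have sf x y : s (f x y) = s y /\ t (f x y) = t y by apply/bst.
have pg x y : p (g x y) = p x /\ s (g x y) = s x by apply/cps; rewrite kH.
have qg x y : q (g x y) = q y /\ t (g x y) = t y by apply/dqt; rewrite kH.
(* Four edges, one for each projection, are assembled by [g] and then [f] into an edge from [x] to
   [y]. *)
have eE x y : e x y = [&& proj P p (p x) (p y), proj Q q (q x) (q y),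
                          proj S s (s x) (s y) & proj T t (t x) (t y)].
  apply/idP/and4P => [exy|]; first by split; apply/projP; exists x, y.
  move=> [/projP[x1 [y1 [e1 px py]]] /projP[x2 [y2 [e2 qx qy]]]].
  move=> /projP[x3 [y3 [e3 sx sy]]] /projP[x4 [y4 [e4 tx ty]]].
  have := ef _ _ _ _ (eg _ _ _ _ e1 e2) (eg _ _ _ _ e3 e4).
  have cellE u1 u2 u3 u4 u : p u1 = p u -> q u2 = q u -> s u3 = s u -> t u4 = t u ->
      f (g u1 u2) (g u3 u4) = u.
    move=> pu qu su tu; apply: inj.
    - by rewrite (pf _ _).1 (pg _ _).1.
    - by rewrite (pf _ _).2 (qg _ _).1.
    - by rewrite (sf _ _).1 (pg _ _).2.
    - by rewrite (sf _ _).2 (qg _ _).2.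
  by rewrite (cellE _ _ _ _ x) // (cellE _ _ _ _ y).
(* A fixed edge fills the coordinates that a single factor does not see. *)
have [x0 [y0 exy0]] : exists x y, e x y.
  by have [a1 ?] := nbrA a0; have [b1 ?] := nbrB b0; exists (a0, b0), (a1, b1); apply/andP.
move: (exy0); rewrite eE => /and4P[P0 Q0 S0 T0].
exists P, Q, S, T, p, q, s, t, (proj P p), (proj Q q), (proj S s), (proj T t).
split=> //; split=> x y.
- apply/idP/idP => [xy|/andP[Pxy Qxy]].
    have : e (f x x0) (f y y0) by apply/andP; split=> //; case/andP: exy0.
    by rewrite eE !(pf _ _).1 !(pf _ _).2 => /and4P[-> -> _ _].
  have : e (f x x0) (f y y0).
    by rewrite eE !(pf _ _).1 !(pf _ _).2 !(sf _ _).1 !(sf _ _).2 Pxy Qxy S0.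
  by case/andP.
- apply/idP/idP => [xy|/andP[Pxy Qxy]].
    have : e (f x0 x) (f y0 y) by apply/andP; split=> //; case/andP: exy0.
    by rewrite eE !(sf _ _).1 !(sf _ _).2 => /and4P[_ _ -> ->].
  have : e (f x0 x) (f y0 y).
    by rewrite eE !(pf _ _).1 !(pf _ _).2 !(sf _ _).1 !(sf _ _).2 Pxy Qxy P0 Q0.
  by case/andP.
- move: exy0; rewrite /e -hr => exy0.
  apply/idP/idP => [xy|/andP[Pxy Qxy]].
    have : e (g x x0) (g y y0).
      by rewrite /e -hr !kH; apply/andP; split=> //; case/andP: exy0.
    by rewrite eE !(pg _ _).1 !(pg _ _).2 => /and4P[-> _ -> _].
  have : e (g x x0) (g y y0).
    by rewrite eE !(pg _ _).1 !(pg _ _).2 !(qg _ _).1 !(qg _ _).2 Pxy Qxy Q0.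
  by rewrite /e -hr !kH; case/andP.
- move: exy0; rewrite /e -hr => exy0.
  apply/idP/idP => [xy|/andP[Pxy Qxy]].
    have : e (g x0 x) (g y0 y).
      by rewrite /e -hr !kH; apply/andP; split=> //; case/andP: exy0.
    by rewrite eE !(qg _ _).1 !(qg _ _).2 => /and4P[_ -> _ ->].
  have : e (g x0 x) (g y0 y).
    by rewrite eE !(pg _ _).1 !(pg _ _).2 !(qg _ _).1 !(qg _ _).2 Pxy Qxy P0 S0.
  by rewrite /e -hr !kH; case/andP.
Qed.

End DirectThinRefinement.

(** * Twin classes, blowups and the general direct product *)

Lemma thin_quotient (T : finType) (r : rel T) : evenly_connected r ->
  exists (U : finType) (q : T -> U) (i : U -> T) (e : rel U),
    [/\ cancel i q, forall x y, r x y = e (q x) (q y),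
        forall x y, q x = q y <-> r x =1 r y, evenly_connected e & thin e].
Proof.
case=> sy n0 nbr co; pose N x := [set y | r x y]%SET.
(* A twin class is represented by the neighbourhood that its members share. *)
pose U : finType := seq_sub (codom N); pose q x : U := SeqSub (codom_f N x).
have qsurj u : exists x, q x = u.
  by case: u => u uN; have /codomP[x E] := uN; exists x; apply: val_inj.
pose i u := sval (cid (qsurj u)); have iK : cancel i q by move=> u; rewrite /i; case: cid.
have qE x y : q x = q y <-> r x =1 r y.
  split=> [/(congr1 val)/= E z|E]; first by have /setP/(_ z) := E; rewrite !inE.
  by apply: val_inj; apply/setP => z; rewrite !inE E.
pose e u v := r (i u) (i v).
have rE x y : r x y = e (q x) (q y).
  have iq z : r (i (q z)) =1 r z by apply/qE; rewrite iK.
  by rewrite /e iq sy -iq sy.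
exists U, q, i, e; split=> // [|u v E].
  split; first by move=> u v; rewrite /e sy.
  - by have /card_gt0P[x _] := n0; apply/card_gt0P; exists (q x).
  - by move=> u; have [y uy] := nbr (i u); exists (q y); rewrite -(iK u) -rE.
  move=> u v; rewrite -(iK u) -(iK v); apply: connect_map (co _ _) => x y.
  by case/sqrelP=> z xz zy; apply/connect1/sqrelP; exists (q z); rewrite -rE.
by rewrite -(iK u) -(iK v); apply/qE => z; rewrite !rE !iK.
Qed.

(** Replaces each vertex [u] by [w u] twins, undoing the passage to the quotient by twins. *)
Definition blowup (P : finType) (w : P -> nat) (r : rel P) :
    rel {u : P & 'I_(w u)} :=
  fun x y => r (tag x) (tag y).
Arguments blowup {P} w r.

Lemma card_blowup_fiber (P : finType) (w : P -> nat) (u : P) :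
  #|[pred x : {u : P & 'I_(w u)} | tag x == u]| = w u.
Proof.
pose f (j : 'I_(w u)) : {u : P & 'I_(w u)} := Tagged _ j.
have fI : injective f by move=> j j' /eqP; rewrite eq_Tagged => /eqP.
rewrite -[RHS]card_ord -(card_codom fI); apply: eq_card => x; rewrite inE.
apply/eqP/codomP => [|[j ->]//]; case: x => v j /= E; subst v; by exists j.
Qed.

(** Both sides map to [P * Q] with the relation [dirp rP rQ] pulled back, and the fibres over
    [(u, v)] have size [wP u * wQ v], so [iso_of_fibers] applies. *)
Lemma blowup_factor (A U X P Q : finType) (rA : rel A) (e : rel U) (rP : rel P)
    (rQ : rel Q) (qA : A -> U) (a : X -> U) (emb : U -> X) (p : X -> P) (q : X -> Q)
    (wP : P -> nat) (wQ : Q -> nat) :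
  0 < #|A| ->
  (forall x y, rA x y = e (qA x) (qA y)) ->
  cancel emb a ->
  (forall x y, a x = a y <-> p x = p y /\ q x = q y) ->
  (forall u v, exists x, p x = u /\ q x = v) ->
  (forall x y, e (a x) (a y) = rP (p x) (p y) && rQ (q x) (q y)) ->
  (forall x, #|[pred z | qA z == a x]| = wP (p x) * wQ (q x)) ->
  iso rA (dirp (blowup wP rP) (blowup wQ rQ)).
Proof.
move=> /card_gt0P[a0 _] rE embK apq surj eE wE.
have [y1 [y2 _]] : exists (y1 : {u : P & 'I_(wP u)}) (y2 : {u : Q & 'I_(wQ u)}), true.
  have := wE (emb (qA a0)); rewrite embK => E.
  have : 0 < #|[pred z | qA z == qA a0]| by apply/card_gt0P; exists a0; rewrite inE.
  rewrite E muln_gt0 => /andP[P0 Q0].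
  by exists (Tagged (fun u => 'I_(wP u)) (Ordinal P0)), (Tagged (fun u => 'I_(wQ u)) (Ordinal Q0)).
apply: (@iso_of_fibers _ _ (P * Q)%type (fun x => (p (emb (qA x)), q (emb (qA x))))
  (fun y => (tag y.1, tag y.2)) _ _ (dirp rP rQ) (y1, y2)) => //.
  by move=> x y; rewrite rE /dirp /= -eE !embK.
case=> u v; have [x [pu qv]] := surj u v.
transitivity #|[pred z | qA z == a x]|.
  apply: eq_card => z; rewrite !inE -pu -qv /= ?xpair_eqE.
  apply/andP/eqP => [[/eqP E1 /eqP E2]|E].
    by rewrite -[LHS]embK; apply/apq.
  by have [-> ->] := (apq (emb (qA z)) x).1 (etrans (embK _) E).
rewrite wE pu qv -(card_blowup_fiber wP u) -(card_blowup_fiber wQ v) -cardX.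
by apply: eq_card => z; rewrite !inE /= ?xpair_eqE.
Qed.

(** The isomorphism maps twin classes onto twin classes, so it induces one between the products of
    the quotients, whose refinement is known. Class sizes multiply, [weight_refinement] splits them,
    and blowing up the refined quotients restores the twins. *)
Theorem dirp_refinement (A B C D : finType)
    (rA : rel A) (rB : rel B) (rC : rel C) (rD : rel D) :
  evenly_connected rA -> evenly_connected rB ->
  evenly_connected rC -> evenly_connected rD ->
  iso (dirp rA rB) (dirp rC rD) ->
  exists (P Q S T : finType) (rP : rel P) (rQ : rel Q) (rS : rel S) (rT : rel T),
    [/\ evenly_connected rP, evenly_connected rQ,
        evenly_connected rS & evenly_connected rT] /\
    [/\ iso rA (dirp rP rQ), iso rB (dirp rS rT), iso rC (dirp rP rS) &
        iso rD (dirp rQ rT)].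
Proof.
move=> ecA ecB ecC ecD [h [k hK kH] hr].
have [UA [qA [iA [eA [iAK rAE tA ecUA thA]]]]] := thin_quotient ecA.
have [UB [qB [iB [eB [iBK rBE tB ecUB thB]]]]] := thin_quotient ecB.
have [UC [qC [iC [eC [iCK rCE tC ecUC thC]]]]] := thin_quotient ecC.
have [UD [qD [iD [eD [iDK rDE tD ecUD thD]]]]] := thin_quotient ecD.
have tw x y : (qA x.1 = qA y.1 /\ qB x.2 = qB y.2) <->
    (qC (h x).1 = qC (h y).1 /\ qD (h x).2 = qD (h y).2).
  rewrite tA tB tC tD -(dirp_twin ecA ecB) -(dirp_twin ecC ecD).
  by split=> E z; [rewrite -(kH z) !hr|rewrite -!hr].
pose x_ (u : UA * UB) := (iA u.1, iB u.2); pose y_ (v : UC * UD) := (iC v.1, iD v.2).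
pose H (u : UA * UB) := (qC (h (x_ u)).1, qD (h (x_ u)).2).
pose K (v : UC * UD) := (qA (k (y_ v)).1, qB (k (y_ v)).2).
have HK : cancel H K.
  move=> u; have [] := (tw (k (y_ (H u))) (x_ u)).2.
    by rewrite kH /= iCK iDK.
  by rewrite /= iAK iBK /K => -> ->; rewrite -surjective_pairing.
have KH : cancel K H.
  move=> v; have [] := (tw (x_ (K v)) (k (y_ v))).1.
    by rewrite /= iAK iBK.
  by rewrite /= kH /= iCK iDK /H => -> ->; rewrite -surjective_pairing.
have Hr x y : dirp eC eD (H x) (H y) = dirp eA eB x y.
  rewrite /dirp /= -rCE -rDE; have := hr (x_ x) (x_ y); rewrite /dirp => ->.
  by rewrite /= rAE rBE !iAK !iBK.
pose wA u := #|[pred x | qA x == u]|; pose wB u := #|[pred x | qB x == u]|.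
pose wC u := #|[pred x | qC x == u]|; pose wD u := #|[pred x | qD x == u]|.
(* A twin class of a product is a product of twin classes, and [h] maps classes bijectively. *)
have W u : wA u.1 * wB u.2 = wC (H u).1 * wD (H u).2.
  rewrite /wA /wB /wC /wD -!cardX -(fintype.card_image (can_inj hK)).
  apply: eq_card => z; rewrite -(kH z) fintype.mem_image; last exact: can_inj hK.
  rewrite !inE; have := tw (k z) (x_ u); rewrite /= iAK iBK => E.
  by apply/andP/andP => -[/eqP E1 /eqP E2]; [have [] := E.1 (conj E1 E2)|
    have [] := E.2 (conj E1 E2)] => -> ->.
have [P [Q [S [T [p [q [s [t [rP [rQ [rS [rT]]]]]]]]]]]] :=
  direct_thin_refinement ecUA ecUB ecUC ecUD thA thB thC thD HK KH Hr.
move=> [[apq bst cps dqt] surj [syP syQ syS syT] [eAE eBE eCE eDE]].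
have [_ nA _ _] := ecA; have [_ nB _ _] := ecB.
have [_ nC _ _] := ecC; have [_ nD _ _] := ecD.
have /card_gt0P[a0 _] := nA; have /card_gt0P[b0 _] := nB.
pose o := (qA a0, qB b0).
have cell u v w r : {x | [/\ p x = u, q x = v, s x = w & t x = r]} by apply: cid.
pose x4 u v w r := sval (cell u v w r).
have x4E u v w r : [/\ p (x4 u v w r) = u, q (x4 u v w r) = v,
    s (x4 u v w r) = w & t (x4 u v w r) = r] by rewrite /x4; case: (cell u v w r).
(* Class sizes as functions of the refined coordinates; [o] fills the coordinates on which they do
   not depend. *)
pose WA u v := wA (x4 u v (s o) (t o)).1; pose WB w r := wB (x4 (p o) (q o) w r).2.
pose WC u w := wC (H (x4 u (q o) w (t o))).1; pose WD v r := wD (H (x4 (p o) v (s o) r)).2.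
have WAE x : wA x.1 = WA (p x) (q x).
  by congr wA; apply/apq; have [-> -> _ _] := x4E (p x) (q x) (s o) (t o).
have WBE x : wB x.2 = WB (s x) (t x).
  by congr wB; apply/bst; have [_ _ -> ->] := x4E (p o) (q o) (s x) (t x).
have WCE x : wC (H x).1 = WC (p x) (s x).
  by congr wC; apply/cps; have [-> _ -> _] := x4E (p x) (q o) (s x) (t o).
have WDE x : wD (H x).2 = WD (q x) (t x).
  by congr wD; apply/dqt; have [_ -> _ ->] := x4E (p o) (q x) (s o) (t x).
have gt0 (Y U : finType) (f : Y -> U) (i : U -> Y) u : cancel i f ->
    0 < #|[pred x | f x == u]|.
  by move=> iK; apply/card_gt0P; exists (i u); rewrite inE iK.
have WE u v w r : WA u v * WB w r = WC u w * WD v r.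
  have := W (x4 u v w r); rewrite WAE WBE WCE WDE.
  by have [-> -> -> ->] := x4E u v w r.
have [fP [fQ [fS [fT [EA EB EC ED]]]]] := @weight_refinement P Q S T (p o) (q o)
  (s o) (t o) WA WB WC WD (fun _ _ => gt0 _ _ _ _ _ iAK) (fun _ _ => gt0 _ _ _ _ _ iBK)
  (fun _ _ => gt0 _ _ _ _ _ iCK) WE.
have isoA : iso rA (dirp (blowup fP rP) (blowup fQ rQ)).
  apply: (@blowup_factor A UA _ P Q rA eA rP rQ qA fst (fun u => (u, o.2)) p q) => //.
    by move=> u v; have [x [? ? _ _]] := surj u v (s o) (t o); exists x.
  by move=> x; rewrite -EA -WAE.
have isoB : iso rB (dirp (blowup fS rS) (blowup fT rT)).
  apply: (@blowup_factor B UB _ S T rB eB rS rT qB snd (fun u => (o.1, u)) s t) => //.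
    by move=> u v; have [x [_ _ ? ?]] := surj (p o) (q o) u v; exists x.
  by move=> x; rewrite -EB -WBE.
have isoC : iso rC (dirp (blowup fP rP) (blowup fS rS)).
  apply: (@blowup_factor C UC _ P S rC eC rP rS qC (fst \o H) (fun u => K (u, (H o).2)) p s) => //.
  - by move=> u; rewrite /comp KH.
  - by move=> u v; have [x [? _ ? _]] := surj u (q o) v (t o); exists x.
  by move=> x; rewrite -EC -WCE.
have isoD : iso rD (dirp (blowup fQ rQ) (blowup fT rT)).
  apply: (@blowup_factor D UD _ Q T rD eD rQ rT qD (snd \o H) (fun u => K ((H o).1, u)) q t) => //.
  - by move=> u; rewrite /comp KH.
  - by move=> u v; have [x [_ ? _ ?]] := surj (p o) u (s o) v; exists x.
  by move=> x; rewrite -ED -WDE.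
have sy_blowup (U : finType) (f : U -> nat) (r : rel U) : symmetric r -> symmetric (blowup f r).
  by move=> sy x y; apply: sy.
do 4!eexists; exists (blowup fP rP), (blowup fQ rQ), (blowup fS rS), (blowup fT rT).
split=> //; split.
- exact: evenly_connected_factor (sy_blowup _ _ _ syP) (evenly_connected_iso isoA ecA).
- exact: evenly_connected_factor (sy_blowup _ _ _ syQ) (evenly_connected_iso isoD ecD).
- exact: evenly_connected_factor (sy_blowup _ _ _ syS) (evenly_connected_iso isoB ecB).
- apply: evenly_connected_factor (sy_blowup _ _ _ syT) _.
  exact: evenly_connected_iso (iso_trans isoB (dirpC _ _)) ecB.
Qed.

(** * The strong product *)

Definition strongp (T1 T2 : finType) (r1 : rel T1) (r2 : rel T2) : rel (T1 * T2)%type :=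
  fun x y => if x == y then r1 x.1 x.1 || r2 x.2 x.2
    else ((x.1 == y.1) || r1 x.1 y.1) && ((x.2 == y.2) || r2 x.2 y.2).

(** Closed adjacency, which turns the strong product into the direct product. *)
Definition with_loops (T : finType) (r : rel T) : rel T :=
  fun x y => (x == y) || r x y.

Definition without_loops (T : finType) (r : rel T) : rel T :=
  fun x y => (x != y) && r x y.

Lemma with_loops_strongp (T1 T2 : finType) (r1 : rel T1) (r2 : rel T2) x y :
  with_loops (strongp r1 r2) x y = dirp (with_loops r1) (with_loops r2) x y.
Proof.
case: x y => [x1 x2] [y1 y2]; rewrite /with_loops /strongp /dirp xpair_eqE /=.
by case: (x1 == y1); case: (x2 == y2).
Qed.

Lemma strongp_iso (T1 T2 T1' T2' : finType) (r1 : rel T1) (r2 : rel T2)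
    (r1' : rel T1') (r2' : rel T2') :
  iso r1 r1' -> iso r2 r2' -> iso (strongp r1 r2) (strongp r1' r2').
Proof.
move=> [h [h' hK h'K] hr] [k [k' kK k'K] kr].
exists (fun x => (h x.1, k x.2)).
  by exists (fun x => (h' x.1, k' x.2)) => -[x y] /=; rewrite ?hK ?kK ?h'K ?k'K.
move=> [x1 x2] [y1 y2].
by rewrite /strongp !xpair_eqE /= !hr !kr !(can_eq hK, can_eq kK).
Qed.

Lemma strongpC (T1 T2 : finType) (r1 : rel T1) (r2 : rel T2) :
  iso (strongp r1 r2) (strongp r2 r1).
Proof.
exists (fun x => (x.2, x.1)); first by exists (fun x => (x.2, x.1)) => -[].
move=> [x1 x2] [y1 y2]; rewrite /strongp !xpair_eqE /= andbC.
by rewrite orbC [X in if _ then _ else X]andbC.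
Qed.

Lemma strongpA (T1 T2 T3 : finType) (r1 : rel T1) (r2 : rel T2) (r3 : rel T3) :
  iso (strongp r1 (strongp r2 r3)) (strongp (strongp r1 r2) r3).
Proof.
exists (fun x => ((x.1, x.2.1), x.2.2)).
  by exists (fun x => (x.1.1, (x.1.2, x.2))) => [[? []]|[[]]].
move=> [x1 [x2 x3]] [y1 [y2 y3]]; rewrite /strongp /= !xpair_eqE !eqxx /=.
by case: (x1 == y1); case: (x2 == y2); case: (x3 == y3);
  rewrite /= ?orbA ?orbF ?orbT ?andbT ?andbA.
Qed.

Lemma strongp1 (T : finType) (r : rel T) : iso (strongp (@adj K1) r) r.
Proof.
exists snd; first by exists (fun x => (ord0, x)) => [[u x]|//]; rewrite [u]ord1.
move=> [u x] [v y]; rewrite /strongp xpair_eqE /= [u]ord1 [v]ord1 eqxx /=.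
by rewrite /adj /= ffunE /=; case: eqP => [->|].
Qed.

Lemma simple_connected_strongp (T1 T2 : finType) (r1 : rel T1) (r2 : rel T2) :
  simple_connected r1 -> simple_connected r2 -> simple_connected (strongp r1 r2).
Proof.
move=> c1 c2; have [_ _ n0 co] := simple_connected_cart c1 c2.
have [sy1 ir1 _ _] := c1; have [sy2 ir2 _ _] := c2; split=> //.
- move=> x y; rewrite /strongp eq_sym; case: eqP => [->//|_].
  by rewrite (eq_sym x.1) (eq_sym x.2) sy1 sy2.
- by move=> x; rewrite /strongp eqxx ir1 ir2.
move=> x y; apply: (connect_map (h := id)) (co x y) => u v uv.
apply: connect1; rewrite /strongp; case: eqP => [uv'|_].
  by move: uv; rewrite uv' /cart ir1 ir2 andbF.
by case/orP: uv => /andP[-> ->]; rewrite ?orbT.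
Qed.

Lemma evenly_connected_with_loops (T : finType) (r : rel T) :
  simple_connected r -> evenly_connected (with_loops r).
Proof.
move=> [sy ir n0 co]; split=> //.
- by move=> x y; rewrite /with_loops eq_sym sy.
- by move=> x; exists x; rewrite /with_loops eqxx.
move=> x y; apply: (connect_map (h := id)) (co x y) => u v uv.
by apply/connect1/sqrelP; exists u; rewrite /with_loops ?eqxx // uv orbT.
Qed.

Lemma simple_connected_without_loops (T : finType) (r : rel T) :
  evenly_connected r -> simple_connected (without_loops r).
Proof.
move=> ec; have [sy n0 _ _] := ec.
have [_ _ co _] := (evenly_connectedP r).2 ec; split=> //.
- by move=> x y; rewrite /without_loops eq_sym sy.
- by move=> x; rewrite /without_loops eqxx.
move=> x y; apply: (connect_map (h := id)) (co x y) => u v uv.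
case: (eqVneq u v) => [->|nuv]; first exact: connect0.
by apply: connect1; rewrite /without_loops nuv.
Qed.

(** Every vertex on the left has a loop, which forces loops at every vertex of both factors; the
    strong product of the loopless factors then has the same edges between distinct vertices. *)
Lemma iso_without_loops (T T1 T2 : finType) (r : rel T) (r1 : rel T1) (r2 : rel T2) :
  irreflexive r -> 0 < #|T| -> iso (with_loops r) (dirp r1 r2) ->
  iso r (strongp (without_loops r1) (without_loops r2)).
Proof.
move=> ir n0 [h [k hK kH] hr]; exists h; first by exists k.
move=> x y.
have loop z : r1 z.1 z.1 && r2 z.2 z.2.
  by have := hr (k z) (k z); rewrite kH /with_loops eqxx.
rewrite /strongp (can_eq hK); case: eqP => [->|/eqP nxy].
  by rewrite /without_loops !eqxx ir.
have -> : r x y = dirp r1 r2 (h x) (h y) by rewrite hr /with_loops (negbTE nxy).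
rewrite /dirp /without_loops; have /andP[l1 l2] := loop (h x).
by case: eqP => [<-|_]; case: eqP => [<-|_]; rewrite ?l1 ?l2.
Qed.

(** Add all loops, refine the resulting direct products, then delete the loops from the four
    factors. *)
Theorem strongp_refinement (A B C D : finType)
    (rA : rel A) (rB : rel B) (rC : rel C) (rD : rel D) :
  simple_connected rA -> simple_connected rB ->
  simple_connected rC -> simple_connected rD ->
  iso (strongp rA rB) (strongp rC rD) ->
  exists (P Q S T : finType) (rP : rel P) (rQ : rel Q) (rS : rel S) (rT : rel T),
    [/\ simple_connected rP, simple_connected rQ,
        simple_connected rS & simple_connected rT] /\
    [/\ iso rA (strongp rP rQ), iso rB (strongp rS rT), iso rC (strongp rP rS) &
        iso rD (strongp rQ rT)].
Proof.
move=> cA cB cC cD [h bh hr].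
have i : iso (dirp (with_loops rA) (with_loops rB))
             (dirp (with_loops rC) (with_loops rD)).
  exists h => // x y; rewrite -!with_loops_strongp /with_loops hr.
  by rewrite (inj_eq (bij_inj bh)).
have [P [Q [S [T [rP [rQ [rS [rT [[cP cQ cS cT] [iA iB iC iD]]]]]]]]]] :=
  dirp_refinement (evenly_connected_with_loops cA) (evenly_connected_with_loops cB)
    (evenly_connected_with_loops cC) (evenly_connected_with_loops cD) i.
exists P, Q, S, T, (without_loops rP), (without_loops rQ), (without_loops rS),
  (without_loops rT).
have no_loops (T0 T1 T2 : finType) (r : rel T0) (r1 : rel T1) (r2 : rel T2) :
    simple_connected r -> iso (with_loops r) (dirp r1 r2) ->
    iso r (strongp (without_loops r1) (without_loops r2)).
  by case=> _ ir n0 _; apply: iso_without_loops.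
split; split; try exact: simple_connected_without_loops; exact: no_loops.
Qed.

(** * Units, complete graphs and the three rings *)

Lemma canon_point (G : graph) : tag G = 1 -> canon G = G.
Proof.
move=> G1; have [h _ hr] := canon_iso G; move: G1 h hr.
rewrite /canon; case: pickP => // r _; case: G r => n g r /= n1; subst n.
move=> h hr; congr (Tagged _ _); apply/ffunP => -[u v].
by have := hr u v; rewrite /adj /= [h u]ord1 [h v]ord1 [u]ord1 [v]ord1.
Qed.

Lemma evenly_connected_K1loop : evenly_connected (@adj K1loop).
Proof.
split; first by move=> x y; rewrite [x]ord1 [y]ord1.
- by rewrite card_ord.
- by move=> x; exists x; rewrite /adj ffunE.
- by move=> x y; rewrite [x]ord1 [y]ord1 connect0.
Qed.

Lemma evenly_connected_card1 (T : finType) (r : rel T) :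
  evenly_connected r -> #|T| = 1 -> iso (@adj K1loop) r.
Proof.
move=> [_ _ nbr _] c1; have [x xP] := fintype1 c1.
exists (fun=> x); first by exists (fun=> ord0) => y; rewrite ?xP // [y]ord1.
by move=> u v; have [y xy] := nbr x; rewrite -{2}(xP y) xy /adj ffunE.
Qed.

(** All loops are included, so the cases of one and two vertices are nonbipartite too. *)
Lemma evenly_connected_complete n : 0 < n -> exists r : rel 'I_n, evenly_connected r.
Proof.
move=> n0; exists (fun _ _ => true); split.
- by [].
- by rewrite card_ord.
- by move=> x; exists x.
- by move=> x y; apply: connect1; apply/existsP; exists x.
Qed.

(** Each item instantiates [ring_iso_of_refinement] with its product and class; for the direct
    product, nonbipartite connectedness is replaced by even connectedness. *)
Theorem mainTheorem3 :
  [/\ ring_iso_to_Zpoly conn_simple (wmul cartesian) << K1 >>%R,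
      ring_iso_to_Zpoly conn_simple (wmul strong) << K1 >>%R &
      ring_iso_to_Zpoly conn_nonbip (wmul direct) << K1loop >>%R].
Proof.
have simple_gt0 (T : finType) (r : rel T) : simple_connected r -> 0 < #|T| by case.
have even_gt0 (T : finType) (r : rel T) : evenly_connected r -> 0 < #|T| by case.
split.
- apply: (ring_iso_of_refinement cart_iso cartC cartA cart1 simple_connected_iso
    simple_connected_cart simple_connected_K1 simple_gt0 simple_connected_card1
    simple_connected_complete cart_refinement conn_simpleP) => //.
  exact: canon_point.
- apply: (ring_iso_of_refinement strongp_iso strongpC strongpA strongp1
    simple_connected_iso simple_connected_strongp simple_connected_K1 simple_gt0
    simple_connected_card1 simple_connected_complete strongp_refinement
    conn_simpleP) => //.
  exact: canon_point.
- apply: (ring_iso_of_refinement dirp_iso dirpC dirpA dirp1 evenly_connected_iso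
    evenly_connected_dirp evenly_connected_K1loop even_gt0 evenly_connected_card1
    evenly_connected_complete dirp_refinement) => // [G|].
    by rewrite conn_nonbipP evenly_connectedP.
  exact: canon_point.
Qed.
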